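(* Let $f\in\mathbb Z[X]$ and let $D$ be a fundamental discriminant. Suppose that $f(n)$ is prime for infinitely many integers $n\ge 0$, and that the integers $n\ge 0$ for which $f(n)$ is prime are asymptotically equidistributed over the residue classes $a \pmod{D}$ with $\gcd(f(a),D)=1$. Then the proportion $\tau_D^-(f)$ of primes of the form $p=f(n)$ ($n\ge0$) that are inert in the quadratic field of discriminant $D$ exists and is a rational number. Moreover, let $D_1$ be the largest odd divisor of $D$ and assume $D_1>1$. For $j=1,3,5,7$ put $$\alpha_j=\frac{\#\{s \bmod 8: f(s)\equiv j \pmod 8\}}{4\,\#\{s\bmod 2: f(s)\equiv 1\pmod 2\}}.$$ Then $$2\tau_D^-(f)=\begin{cases}1-a_{D_1}(f) & \text{if } D \text{ is odd};\\ 1+(\alpha_3+\alpha_7-\alpha_1-\alpha_5)a_{D_1}(f) & \text{if } D\equiv 4\pmod 8;\\ 1+(\alpha_3+\alpha_5-\alpha_1-\alpha_7)a_{D_1}(f) & \text{if } D\equiv 8\pmod{32};\\ 1+(\alpha_5+\alpha_7-\alpha_1-\alpha_3)a_{D_1}(f) & \text{if } D\equiv 24\pmod{32},\end{cases}$$ where $a_{D_1}(f)=\prod_{p\mid D_1}a_p(f)$ and, for an odd prime $p$, $$a_p(f)=\frac{\sum_{j=0}^{p-1}\left(\frac{f(j)}{p}\right)}{p-N_p(f)}.$$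
   Context: $\left(\frac{\cdot}{p}\right)$ is the Legendre symbol. $N_p(f)=\#\{n \bmod p: f(n)\equiv 0\pmod p\}$. The proportion $\tau_D^-(f)$ is the limit as $x\to\infty$ of the number of primes $p\le x$ of the form $f(n)$ with $n\ge 0$ that are inert in $\mathbb Q(\sqrt D)$, divided by the number of primes $p\le x$ of the form $f(n)$ with $n\ge0$. Equidistribution means that for each residue class $a\bmod D$ with $\gcd(f(a),D)=1$, the number of $n\le x$, $n\equiv a\pmod D$, with $f(n)$ prime is asymptotic to the total number of $n\le x$ with $f(n)$ prime divided by the number of such residue classes. *)

(* Defs.v *)
From HB Require Import structures.
From mathcomp Require Import all_boot all_order all_algebra all_field.
From mathcomp Require Import all_classical all_reals all_analysis.
Set Implicit Arguments.
Unset Strict Implicit.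
Unset Printing Implicit Defensive.
Import Order.TTheory GRing.Theory Num.Theory.
Import numFieldNormedType.Exports.
Local Open Scope ring_scope.

Definition squarefreez (m : int) : Prop :=
  forall d : nat, (d%:Z ^+ 2 %| m)%Z -> d = 1%N.

(* Discriminants of quadratic fields; hence D = 1 is excluded. *)
Definition fundamental_discriminant (D : int) : Prop :=
  D <> 1 /\
  ((D = 1 %[mod 4])%Z /\ squarefreez D \/
   exists m : int,
     [/\ D = 4 * m, (m = 2 %[mod 4])%Z \/ (m = 3 %[mod 4])%Z & squarefreez m]).

Definition quadratic_field (D : int) (z : algC) : Prop :=
  exists a b : rat, z = ratr a + ratr b * sqrtC D%:~R.

Definition quadratic_integer (D : int) (z : algC) : Prop :=
  quadratic_field D z /\ z \in Aint.

Definition principal_ideal (D : int) (p : nat) (z : algC) : Prop :=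
  exists2 y, quadratic_integer D y & z = p%:R * y.

(* A rational prime p is inert when the ideal it generates in the ring of
   integers is prime. *)
Definition inert (D : int) (p : nat) : Prop :=
  ~ principal_ideal D p 1 /\
  forall x y : algC, quadratic_integer D x -> quadratic_integer D y ->
    principal_ideal D p (x * y) -> principal_ideal D p x \/ principal_ideal D p y.

(* Negative integers are never prime. *)
Definition primez (z : int) : bool := if z is Posz p then prime p else false.

Definition represented (f : {poly int}) (p : nat) : Prop :=
  exists n : nat, f.[n%:Z] = p%:Z.

Definition nb_primes (f : {poly int}) (x : nat) : nat :=
  #|[pred p : 'I_x.+1 | prime p && `[< represented f p >]]|.

Definition nb_inert_primes (D : int) (f : {poly int}) (x : nat) : nat :=
  #|[pred p : 'I_x.+1 | [&& prime p, `[< represented f p >] & `[< inert D p >]]]|.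

Definition inert_ratio (R : realType) (D : int) (f : {poly int}) (x : nat) : R :=
  (nb_inert_primes D f x)%:R / (nb_primes f x)%:R.

Definition tau_minus (R : realType) (D : int) (f : {poly int}) : R :=
  limn (inert_ratio R D f).

Definition nb_prime_args (f : {poly int}) (x : nat) : nat :=
  #|[pred n : 'I_x.+1 | primez f.[(n : nat)%:Z]]|.

Definition nb_prime_args_in (m a : nat) (f : {poly int}) (x : nat) : nat :=
  #|[pred n : 'I_x.+1 | (n == a %[mod m])%N && primez f.[(n : nat)%:Z]]|.

Definition admissible (D : int) (f : {poly int}) (a : nat) : bool :=
  coprimez f.[a%:Z] D.

Definition nb_admissible (D : int) (f : {poly int}) : nat :=
  #|[pred a : 'I_`|D|%N | admissible D f a]|.

Definition equidistributed (R : realType) (D : int) (f : {poly int}) : Prop :=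
  forall a : 'I_`|D|%N, admissible D f a ->
    ((fun x : nat => (nb_prime_args_in `|D|%N a f x)%:R /
        ((nb_prime_args f x)%:R / (nb_admissible D f)%:R) : R) @ \oo --> (1 : R))%classic.

Definition legendre (a : int) (p : nat) : int :=
  if (p%:Z %| a)%Z then 0
  else if [exists y : 'I_p, ((y : nat)%:Z ^+ 2 == a %[mod p%:Z])%Z] then 1
  else -1.

Definition nb_roots (p : nat) (f : {poly int}) : nat :=
  #|[pred n : 'I_p | (f.[(n : nat)%:Z] == 0 %[mod p%:Z])%Z]|.

Definition a_prime (R : realType) (f : {poly int}) (p : nat) : R :=
  (\sum_(j < p) legendre f.[(j : nat)%:Z] p)%:~R / (p%:R - (nb_roots p f)%:R).

Definition largest_odd_divisor (D : int) : nat :=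
  \max_(d <- divisors `|D|%N | odd d) d.

Definition a_coef (R : realType) (f : {poly int}) (m : nat) : R :=
  \prod_(p <- primes m) a_prime R f p.

Definition nb_residues (m j : nat) (f : {poly int}) : nat :=
  #|[pred s : 'I_m | (f.[(s : nat)%:Z] == j%:Z %[mod m%:Z])%Z]|.

Definition alpha (R : realType) (f : {poly int}) (j : nat) : R :=
  (nb_residues 8 j f)%:R / (4 * (nb_residues 2 1 f)%:R).

(* The quotients a_p(f), for p dividing the odd part of D, and alpha_j, which
   matter only for even D, have nonzero denominators.  When f takes infinitely
   many prime values this fails only if f is a constant prime dividing D, and
   then these quotients are 0 / 0. *)
Definition coefficients_defined (D : int) (f : {poly int}) : Prop :=
  (forall p : nat, p \in primes (largest_odd_divisor D) -> nb_roots p f <> p) /\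
  ((2 %| D)%Z -> nb_residues 2 1 f <> 0%N).

(* Main.v *)
(** Let D1 be the odd part of |D| and write D = d * prod_{q | D1} q* with d in
    {1, -4, 8, -8} and q* = (-1)^((q-1)/2) q.  Each q* is the square of a quadratic
    Gauss sum, and -1 and 2 are squares in the 4th and 8th cyclotomic rings; raising
    these square roots to the p-th power modulo p gives
    sqrt(D)^p = chi(p) sqrt(D) (mod p), where chi is the product of a character modulo
    d and of the Legendre symbols (./q).  Hence y^p is congruent to y or to its
    conjugate for every quadratic integer y, and p is inert exactly when chi(p) = -1:
    this replaces quadratic reciprocity.

    Since chi(f(n)) depends only on n modulo D, equidistribution makes
    #{a mod D : chi(f(a)) = -1} / #{a mod D : gcd(f(a), D) = 1} the limit over arguments;
    passing from arguments to values changes the counts by a bounded amount because f is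
    eventually increasing.  The numerator is (A - S)/2, where S and A are the sums of
    chi(f(a)) and of its square, and both factor by the Chinese remainder theorem. *)
Require Import Defs.
From HB Require Import structures.
From mathcomp Require Import all_boot all_order all_algebra all_field.
From mathcomp Require Import cyclic.
From mathcomp Require Import all_classical all_reals all_analysis.
From mathcomp Require Import ring zify.
Set Implicit Arguments.
Unset Strict Implicit.
Unset Printing Implicit Defensive.
Import Order.TTheory GRing.Theory Num.Theory.
Import numFieldNormedType.Exports.
Local Open Scope ring_scope.

(** * Legendre symbols *)

(** Inertness is stated as primality of an ideal, so the link with the character is made entirely by
    congruences modulo p among algebraic integers; they restrict correctly to Z because a rational
    algebraic integer is an integer. The obstacle is that the ring of integers is larger than
    Z[sqrt D], and that for p = 2 the congruence for sqrt D says nothing about it. For odd p, the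
    multiple of a quadratic integer by 2D lies in Z[sqrt D], and 2D can be cancelled modulo p. For p
    = 2, sqrt D gives way to (1 + sqrt D)/2, whose square modulo 2 depends on D modulo 8. The class
    of D modulo 8 is tied to chi(2) by the supplementary law for (2/q), which comes from comparing
    the Frobenius on sqrt 2 with Euler's criterion. A second obstacle is that a constant prime f
    satisfies the hypotheses: infinitely many arguments give a single prime, so the passage from
    arguments to values fails and this case is computed directly. *)

Lemma Fp_intr_eq q (m n : int) : prime q ->
  (m%:~R == n%:~R :> 'F_q) = (m == n %[mod q%:Z])%Z.
Proof.
by move=> q_pr; rewrite eqz_mod_dvd (dvdz_pcharf (pchar_Fp q_pr)) rmorphB subr_eq0.
Qed.

Lemma legendre_values a q : [\/ legendre a q = 0, legendre a q = 1 | legendre a q = -1].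
Proof.
by rewrite /legendre; case: ifP => _; [exact: Or31|case: ifP => _; [exact: Or32|exact: Or33]].
Qed.

Lemma legendre_eq0 a q : (legendre a q == 0) = (q%:Z %| a)%Z.
Proof. by rewrite /legendre; case: ifP => // _; case: ifP. Qed.

Lemma legendre_mod a b q : (a = b %[mod q%:Z])%Z -> legendre a q = legendre b q.
Proof.
move=> ab; rewrite /legendre.
have dvdE x : (q%:Z %| x)%Z = (x == 0 %[mod q%:Z])%Z by rewrite eqz_mod_dvd subr0.
rewrite !dvdE ab; do 2!congr (if _ then _ else _).
Qed.

Lemma Fp_size_nonzero q : prime q -> size [seq y <- enum 'F_q | y != 0] = q.-1.
Proof.
move=> q_pr; rewrite size_filter.
have := count_predC (pred1 (0 : 'F_q)) (enum 'F_q).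
rewrite -cardE card_Fp // count_uniq_mem ?enum_uniq // mem_enum inE /= => H.
by apply: succn_inj; rewrite prednK ?prime_gt0 // -[RHS]H.
Qed.

(** The nonzero classes are powers of a primitive root z of order q - 1. If x = z^i, the hypothesis
    forces q - 1 to divide i (q - 1)/2, so i is even. *)
Lemma Fp_expf_half_eq1 q (x : 'F_q) : prime q -> odd q -> x != 0 ->
  x ^+ q./2 = 1 -> exists y, y ^+ 2 = x.
Proof.
move=> q_pr q_odd x0 xh.
have qE : (q = q./2.*2.+1)%N by rewrite -[LHS]odd_double_half q_odd.
have h0 : (0 < q./2)%N by move: (prime_gt1 q_pr); rewrite qE; case: q./2.
have ucard (y : 'F_q) : y != 0 -> y ^+ q.-1 = 1.
  move=> y0; apply: (mulfI y0); rewrite mulr1 -exprS prednK ?prime_gt0 //.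
  by rewrite -[X in _ ^+ X](card_Fp q_pr) expf_card.
pose rs := [seq y <- enum 'F_q | y != 0].
have sz : size rs = q.-1 by exact: Fp_size_nonzero.
have /hasP[z _ z_pr] : has q.-1.-primitive_root rs.
  apply: has_prim_root; first by rewrite qE /= double_gt0.
  - by apply/allP => y; rewrite mem_filter unity_rootE => /andP[y0 _]; rewrite ucard.
  - by rewrite filter_uniq ?enum_uniq.
  - by rewrite sz.
have [i xE] := prim_rootP z_pr (ucard _ x0).
have : (q.-1 %| i * q./2)%N by rewrite (prim_order_dvd z_pr) exprM -xE xh.
rewrite {1}qE /= -muln2 mulnC dvdn_pmul2r // => /dvdnP[j iE].
by exists (z ^+ j); rewrite -exprM xE iE.
Qed.

Lemma legendre_euler q (a : int) : prime q -> odd q ->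
  (a%:~R : 'F_q) ^+ q./2 = (legendre a q)%:~R.
Proof.
move=> q_pr q_odd.
have qE : (q = q./2.*2.+1)%N by rewrite -[LHS]odd_double_half q_odd.
have h0 : (0 < q./2)%N by move: (prime_gt1 q_pr); rewrite qE; case: q./2.
have a0 : (q%:Z %| a)%Z = (a%:~R == 0 :> 'F_q) by exact: dvdz_pcharf (pchar_Fp q_pr) a.
have ucard (y : 'F_q) : y != 0 -> y ^+ q./2.*2 = 1.
  move=> y0; apply: (mulfI y0); rewrite mulr1 -exprS -qE.
  by rewrite -[X in _ ^+ X](card_Fp q_pr) expf_card.
rewrite /legendre a0; case: eqP => [->|/eqP an0]; first by rewrite expr0n gtn_eqF.
case: ifP => [/existsP[y /eqP ay]|/existsPn nsq].
  have {}ay : (y : nat)%:R ^+ 2 = a%:~R :> 'F_q.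
    by apply/eqP; rewrite -[_%:R]/((y : nat)%:Z%:~R) -rmorphXn Fp_intr_eq // ay.
  have y0 : (y : nat)%:R != 0 :> 'F_q by apply: contraNneq an0 => y0; rewrite -ay y0 expr0n.
  by rewrite -ay -exprM mul2n ucard.
have : (a%:~R ^+ q./2) ^+ 2 == 1 :> 'F_q by rewrite -exprM muln2 ucard.
rewrite sqrf_eq1 => /orP[/eqP /(Fp_expf_half_eq1 q_pr q_odd an0)[y ya]|/eqP -> //].
have yq : (y < q)%N by rewrite -[X in (_ < X)%N](Fp_cast q_pr).
have /negP[] := nsq (Ordinal yq).
rewrite -Fp_intr_eq // rmorphXn /= -ya.
by have -> : (y : nat)%:~R = y by exact: natr_Zp.
Qed.

(** The difference is at most 2 in absolute value and divisible by q >= 3. Identities between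
    symbols can thus be proved in ['F_q], through Euler's criterion, and lifted to the integers. *)
Lemma Fp_sign_inj q (a b : int) : prime q -> odd q -> `|a| <= 1 -> `|b| <= 1 ->
  a%:~R = b%:~R :> 'F_q -> a = b.
Proof.
move=> q_pr q_odd a1 b1 /eqP; rewrite Fp_intr_eq // eqz_mod_dvd => /dvdzP[k kE].
have q3 : (2 < q)%N by case: q q_pr q_odd {kE} => [|[|[|]]].
have [k0|k0] := eqVneq k 0; first by move: kE; rewrite k0; lia.
have : `|k * q%:Z| <= 2 by rewrite -kE; lia.
rewrite normrM; have : `|k| >= 1 by lia.
nia.
Qed.

Lemma legendre_norm a q : `|legendre a q| <= 1.
Proof. by case: (legendre_values a q) => ->. Qed.

Lemma legendreM q a b : prime q -> odd q ->
  legendre (a * b) q = legendre a q * legendre b q.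
Proof.
move=> q_pr q_odd; apply: (Fp_sign_inj q_pr q_odd).
- exact: legendre_norm.
- by rewrite normrM mulr_ile1 // legendre_norm.
by rewrite rmorphM /= -!legendre_euler // rmorphM exprMn.
Qed.

Lemma legendre_sqr q a : prime q ->
  legendre a q ^+ 2 = (~~ (q%:Z %| a)%Z : nat)%:Z.
Proof.
by move=> q_pr; rewrite -legendre_eq0; case: (legendre_values a q) => ->.
Qed.

Lemma legendre_sign q : prime q -> odd q -> legendre (-1) q = (-1) ^+ q./2.
Proof.
move=> q_pr q_odd; apply: (Fp_sign_inj q_pr q_odd).
- exact: legendre_norm.
- by rewrite normrX normrN1 expr1n.
by rewrite -legendre_euler // !rmorphXn /= rmorphN1.
Qed.

(** Otherwise Euler's criterion would make all q - 1 nonzero classes roots of X^((q-1)/2) - 1, which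
    has too few roots. *)
Lemma exists_nonresidue q : prime q -> odd q ->
  exists c : nat, legendre c q = -1.
Proof.
move=> q_pr q_odd; apply: contrapT => noc.
have qE : (q = q./2.*2.+1)%N by rewrite -[LHS]odd_double_half q_odd.
have h0 : (0 < q./2)%N by move: (prime_gt1 q_pr); rewrite qE; case: q./2.
pose rs := [seq y <- enum 'F_q | y != 0].
have sz : size rs = q.-1 by exact: Fp_size_nonzero.
have : (size rs <= q./2)%N.
  apply: max_unity_roots => //; last by rewrite filter_uniq ?enum_uniq.
  apply/allP => y; rewrite mem_filter => /andP[y0 _].
  have yE : (y : nat)%:Z%:~R = y by exact: natr_Zp.
  rewrite unity_rootE -{1}yE legendre_euler //.
  case: (legendre_values (y : nat) q) => [/eqP|->//|yN].
    by rewrite legendre_eq0 (dvdz_pcharf (pchar_Fp q_pr)) yE (negPf y0).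
  by case: noc; exists (y : nat).
by rewrite sz; lia.
Qed.

(** * Quadratic Gauss sums *)

Lemma Fp_eq_mod q (m : nat) : prime q -> (((m%:R : 'F_q)%R : nat) = m %[mod q])%N.
Proof. by move=> q_pr; rewrite val_Fp_nat // modn_mod. Qed.

Lemma Fp_mul_mod q (x y : 'F_q) : prime q -> (((x * y : 'F_q)%R : nat) = x * y %[mod q])%N.
Proof. by move=> q_pr; rewrite -(Fp_eq_mod (x * y)%N) // natrM !natr_Zp. Qed.

Lemma Fp_add_mod q (x y : 'F_q) : prime q -> (((x + y : 'F_q)%R : nat) = x + y %[mod q])%N.
Proof. by move=> q_pr; rewrite -(Fp_eq_mod (x + y)%N) // natrD !natr_Zp. Qed.

Lemma legendre_modn q (m n : nat) : (m = n %[mod q])%N -> legendre m q = legendre n q.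
Proof. by move=> mn; apply: legendre_mod; rewrite !modz_nat mn. Qed.

Lemma legendre_FpM q (x y : 'F_q) : prime q -> odd q ->
  legendre (x * y : 'F_q)%R q = legendre (x : nat) q * legendre (y : nat) q.
Proof.
move=> q_pr q_odd; rewrite -legendreM //; apply: legendre_modn.
exact: Fp_mul_mod.
Qed.

Lemma Fp_ord_eq0 q (x : 'F_q) : prime q -> (q%:Z %| (x : nat)%:Z)%Z = (x == 0).
Proof.
move=> q_pr; rewrite (dvdz_pcharf (pchar_Fp q_pr)).
by have -> : (x : nat)%:~R = x by exact: natr_Zp.
Qed.

Lemma sum_legendre_Fp q : prime q -> odd q -> \sum_(x : 'F_q) legendre (x : nat) q = 0.
Proof.
move=> q_pr q_odd; have [c cN] := exists_nonresidue q_pr q_odd.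
(* Multiplying the index by a nonresidue permutes the classes and changes the sign of every term. *)
set S := \sum_x _; suff : S = - S by lia.
have cN' : legendre (c%:R : 'F_q) q = -1.
  by rewrite -cN; apply: legendre_modn; exact: Fp_eq_mod.
have c0 : c%:R != 0 :> 'F_q.
  by rewrite -Fp_ord_eq0 // -legendre_eq0 cN'.
rewrite {1}/S (reindex_inj (mulfI c0)) /= -sumrN.
by apply: eq_bigr => x _; rewrite legendre_FpM // cN' mulN1r.
Qed.

Definition gauss_sum (q : nat) (z : algC) : algC :=
  \sum_(x : 'F_q) (legendre (x : nat) q)%:~R * z ^+ x.

(** Replacing x by c x in the Gauss sum brings out (c/q), whose square is 1. The case c = p is what
    the p-th power of a Gauss sum produces modulo p. *)
Lemma gauss_sum_twist q (z : algC) c : prime q -> odd q -> q.-primitive_root z ->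
  ~~ (q %| c)%N ->
  \sum_(x : 'F_q) (legendre (x : nat) q)%:~R * z ^+ (c * x)
    = (legendre c q)%:~R * gauss_sum q z.
Proof.
move=> q_pr q_odd z_pr qc; rewrite mulr_sumr.
have c0 : c%:R != 0 :> 'F_q by rewrite -(dvdn_pcharf (pchar_Fp q_pr)).
rewrite [RHS](reindex_inj (mulfI c0)); apply: eq_bigr => x _.
have -> : legendre (c%:R * x : 'F_q)%R q = legendre c q * legendre (x : nat) q.
  rewrite legendre_FpM //; congr (_ * _).
  by apply: legendre_modn; exact: Fp_eq_mod.
rewrite mulrA -rmorphM mulrA -expr2 legendre_sqr // -[X in ~~ X]/(q %| c)%N qc mul1r.
congr (_ * _); apply/eqP; rewrite (eq_prim_root_expr z_pr) Fp_mul_mod //.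
by apply/eqP; rewrite -[RHS]modnMml Fp_eq_mod // modnMml.
Qed.

Lemma sum_prim_root_Fp q (z : algC) (u : 'F_q) : prime q -> q.-primitive_root z ->
  \sum_(x : 'F_q) z ^+ (x * u : 'F_q)%R = (if u == 0 then q%:R else 0) :> algC.
Proof.
move=> q_pr z_pr; case: eqP => [->|/eqP u0].
  by under eq_bigr do rewrite mulr0 expr0; rewrite sumr_const card_Fp.
(* Shifting x by 1 multiplies every term by z^u, so T vanishes unless z^u = 1. *)
set T := \sum_x _; have : z ^+ u * T = T.
  have shift x : z ^+ u * z ^+ (x * u : 'F_q)%R = z ^+ ((x + 1) * u : 'F_q)%R.
    rewrite -exprD; apply/eqP; rewrite (eq_prim_root_expr z_pr) mulrDl mul1r Fp_add_mod //.
    by rewrite addnC.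
  rewrite mulr_sumr [RHS](reindex_inj (addIr 1)); apply: eq_bigr => x _.
  exact: shift.
move/eqP; rewrite -subr_eq0 -{2}[T]mul1r -mulrBl mulf_eq0 subr_eq0 => /orP[|/eqP //].
rewrite -(prim_order_dvd z_pr) => qu.
by move: (Fp_ord_eq0 u q_pr); rewrite (negPf u0) dvdzE /= qu.
Qed.

Lemma gauss_sum_sqr q z : prime q -> odd q -> q.-primitive_root z ->
  gauss_sum q z ^+ 2 = (legendre (-1) q * q%:Z)%:~R.
Proof.
move=> q_pr q_odd z_pr.
pose L (x : 'F_q) := (legendre (x : nat) q)%:~R : algC.
have LM x y : L (x * y) = L x * L y by rewrite /L legendre_FpM // rmorphM.
have L0 : L 0 = 0 by rewrite /L /legendre dvdz0.
have L2 x : L x ^+ 2 = (x != 0)%:R.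
  by rewrite /L -rmorphXn /= legendre_sqr // Fp_ord_eq0.
(* The second index is written x t, so that the product of the two symbols is L(x)^2 L(t). *)
have -> : gauss_sum q z ^+ 2 =
    \sum_(x : 'F_q) \sum_(t : 'F_q) L x ^+ 2 * L t * z ^+ (x * (1 + t))%R.
  rewrite expr2 {1}/gauss_sum mulr_suml; apply: eq_bigr => x _.
  have [->|x0] := eqVneq x 0.
    by rewrite -/(L 0) L0 !mul0r big1 // => t _; rewrite expr0n !mul0r.
  rewrite /gauss_sum (reindex_inj (mulfI x0)) mulr_sumr; apply: eq_bigr => t _.
  rewrite -/(L x) -/(L (x * t)) LM mulrACA expr2 -!mulrA; congr (_ * (_ * (_ * _))).
  rewrite -exprD; apply/eqP; rewrite (eq_prim_root_expr z_pr) mulrDr mulr1.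
  by rewrite -Fp_add_mod.
have split0 (F : 'F_q -> algC) : \sum_x F x = F 0 + \sum_(x | x != 0) F x.
  by rewrite (bigD1 0).
rewrite exchange_big.
(* The factor [L x ^+ 2] only removes the term x = 0 from a complete sum of powers of z, hence the
   [- 1]. Its contribution disappears on summing over t because [L] has sum 0, and t = -1 alone
   remains. *)
have inner t : \sum_(x : 'F_q) L x ^+ 2 * L t * z ^+ (x * (1 + t))%R
    = L t * ((if 1 + t == 0 then q%:R else 0) - 1).
  rewrite -(sum_prim_root_Fp (1 + t) q_pr z_pr).
  rewrite split0 [in RHS]split0 !mul0r !expr0 L0 expr0n !mul0r add0r.
  rewrite [in RHS]addrC addKr mulr_sumr.
  by apply: eq_bigr => x x0; rewrite L2 x0 mul1r.
under eq_bigr do rewrite inner mulrBr mulr1.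
rewrite sumrB -[X in _ - X]rmorph_sum sum_legendre_Fp // subr0.
rewrite (bigD1 (-1)) //= subrr eqxx big1 ?addr0 => [|t tN1]; last first.
  by rewrite addrC addr_eq0 (negPf tN1) mulr0.
rewrite rmorphM; congr (_%:~R * _); apply: legendre_mod.
apply/eqP; rewrite -Fp_intr_eq // rmorphN1.
by apply/eqP; exact: natr_Zp.
Qed.

(** * Congruences between algebraic integers *)

Lemma dvdAE (e z : algC) : (e %| z)%A = if e == 0 then z == 0 else z / e \in Aint.
Proof. by rewrite unfold_in. Qed.

Lemma dvdA_natE (p : nat) z : (0 < p)%N -> (p %| z)%A = (z / p%:R \in Aint).
Proof. by move=> p0; rewrite dvdAE pnatr_eq0 eqn0Ngt p0. Qed.

Lemma dvdA_mulr (p : nat) x z : x \in Aint -> (p %| z)%A -> (p %| x * z)%A.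
Proof.
move=> xA; rewrite !dvdAE; case: eqP => [_ /eqP ->|_ zp]; first by rewrite mulr0.
by rewrite -mulrA rpredM.
Qed.

Lemma eqAmod_exp (p n : nat) x y : x \in Aint -> y \in Aint ->
  (x == y %[mod p])%A -> (x ^+ n == y ^+ n %[mod p])%A.
Proof.
move=> xA yA xy; elim: n => [|n IHn]; first by rewrite !expr0.
by rewrite !exprS; apply: eqAmodM; rewrite ?rpredX.
Qed.

Lemma eqAmod_sum (I : Type) (r : seq I) (p : nat) (F G : I -> algC) :
  (forall i, F i == G i %[mod p])%A ->
  (\sum_(i <- r) F i == \sum_(i <- r) G i %[mod p])%A.
Proof.
move=> FG; elim: r => [|i r IHr]; first by rewrite !big_nil.
by rewrite !big_cons; apply: eqAmodD.
Qed.

(** The quotient m/p is rational, and a rational algebraic integer is an integer. *)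
Lemma dvdA_int (p : nat) (m : int) : (0 < p)%N -> (p %| m%:~R)%A = (p%:Z %| m)%Z.
Proof.
move=> p0; rewrite dvdA_natE //.
have p0' : p%:R != 0 :> algC by rewrite pnatr_eq0 -lt0n.
apply/idP/idP => [mA|/dvdzP[k ->]]; last by rewrite rmorphM /= mulfK // Aint_int.
have /intrP[k kE] : (m%:~R / p%:R : algC) \is a Num.int.
  by apply: Cint_rat_Aint => //; rewrite rpred_div ?rpred_nat ?rpred_int.
apply/dvdzP; exists k; apply: (@intr_inj algC).
by rewrite rmorphM /= -kE divfK.
Qed.

Lemma eqAmod_int (p : nat) (m n : int) : (0 < p)%N ->
  (m%:~R == n%:~R %[mod p])%A = (m == n %[mod p%:Z])%Z.
Proof. by move=> p0; rewrite eqz_mod_dvd -dvdA_int // rmorphB. Qed.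

(** By Bezout, u c + v p = 1 writes x/p as u (c x/p) + v x. This is the tool that cancels
    denominators prime to p in congruences. *)
Lemma dvdA_Gauss (p : nat) (c : int) x : (0 < p)%N -> coprimez c p%:Z ->
  x \in Aint -> (p %| c%:~R * x)%A -> (p %| x)%A.
Proof.
move=> p0 /coprimezP[[u v] /= uv] xA.
have p0' : p%:R != 0 :> algC by rewrite pnatr_eq0 -lt0n.
rewrite !dvdA_natE // => cx.
have -> : x / p%:R = u%:~R * (c%:~R * x / p%:R) + v%:~R * x.
  rewrite -[LHS]mul1r -[X in X * _ = _](rmorph1 intr) -uv rmorphD !rmorphM /=.
  by rewrite -[(Posz p)%:~R]/(p%:R); field.
by rewrite rpredD // rpredM // Aint_int.
Qed.

Lemma eqAmod_Frobenius (p : nat) x y : prime p -> x \in Aint -> y \in Aint ->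
  ((x + y) ^+ p == x ^+ p + y ^+ p %[mod p])%A.
Proof.
move=> p_pr xA yA; have p0 := prime_gt0 p_pr.
rewrite exprDn; case: p p_pr p0 => // p p_pr p0.
rewrite big_ord_recl big_ord_recr /=.
rewrite subn0 expr0 mulr1 bin0 mulr1n /bump /= add1n subnn expr0 mul1r binn mulr1n.
rewrite /eqAmod opprD addrACA subrr add0r addrK.
apply: rpred_sum => i _; rewrite add1n.
have /dvdnP[k ->] : (p.+1 %| 'C(p.+1, i.+1))%N.
  by apply: prime_dvd_bin => //=; rewrite ltnS.
rewrite -mulr_natr natrM mulrA; apply: dvdA_mulr; first by rewrite !rpredM ?rpredX ?rpred_nat.
by rewrite dvdA_natE // divff ?Aint1 // pnatr_eq0.
Qed.

Lemma eqAmod_Frobenius_sum (I : Type) (r : seq I) (p : nat) (F : I -> algC) :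
  prime p -> (forall i, F i \in Aint) ->
  ((\sum_(i <- r) F i) ^+ p == \sum_(i <- r) F i ^+ p %[mod p])%A.
Proof.
move=> p_pr FA; elim: r => [|i r IHr].
  by rewrite !big_nil expr0n gtn_eqF ?prime_gt0 // eqAmod_refl.
rewrite !big_cons; apply: eqAmod_trans (eqAmod_Frobenius p_pr _ _) _ => //.
  by apply: rpred_sum.
by rewrite eqAmodDl.
Qed.

Lemma eqAmod_Fermat (p : nat) (m : int) : prime p ->
  (m%:~R ^+ p == m%:~R %[mod p])%A.
Proof.
move=> p_pr; rewrite -rmorphXn /= eqAmod_int ?prime_gt0 // -Fp_intr_eq //.
by rewrite rmorphXn /= -[X in _ ^+ X](card_Fp p_pr) expf_card.
Qed.

Lemma eqAmod_Frobenius_lin (p : nat) (c : int) x : prime p -> x \in Aint ->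
  ((c%:~R * x) ^+ p == c%:~R * x ^+ p %[mod p])%A.
Proof.
move=> p_pr xA; rewrite exprMn.
by apply: eqAmodM (eqAmod_Fermat _ p_pr) (eqAmod_refl _ _); rewrite ?rpredX ?Aint_int.
Qed.

(* The Frobenius at p multiplies a square root of d by e. *)
Definition root_frobenius (p : nat) (d e : int) : Prop :=
  exists2 g : algC, g \in Aint &
    g ^+ 2 = d%:~R /\ (g ^+ p == e%:~R * g %[mod p])%A.

Lemma root_frobeniusM p d1 e1 d2 e2 :
  root_frobenius p d1 e1 -> root_frobenius p d2 e2 ->
  root_frobenius p (d1 * d2) (e1 * e2).
Proof.
move=> [g1 g1A [g1E g1p]] [g2 g2A [g2E g2p]]; exists (g1 * g2); first exact: rpredM.
split; first by rewrite exprMn g1E g2E rmorphM.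
rewrite exprMn rmorphM /= mulrACA.
by apply: eqAmodM => //; rewrite ?rpredX ?rpredM ?Aint_int.
Qed.

Lemma gauss_sum_Aint q z : q.-primitive_root z -> gauss_sum q z \in Aint.
Proof.
move=> z_pr; apply: rpred_sum => x _.
by rewrite rpredM ?Aint_int // rpredX // (Aint_prim_root z_pr).
Qed.

Lemma root_frobenius_prime p q : prime p -> odd p -> prime q -> odd q -> p != q ->
  root_frobenius p (legendre (-1) q * q%:Z) (legendre p q).
Proof.
move=> p_pr p_odd q_pr q_odd pq.
have [z z_pr] := C_prim_root_exists (prime_gt0 q_pr).
have zA := Aint_prim_root z_pr.
exists (gauss_sum q z); first exact: gauss_sum_Aint.
split; first exact: gauss_sum_sqr.
rewrite -gauss_sum_twist // ?dvdn_prime2 ?(eq_sym q) //.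
have termA (x : 'F_q) : (legendre (x : nat) q)%:~R * z ^+ x \in Aint.
  by rewrite rpredM ?Aint_int ?rpredX.
apply: eqAmod_trans (eqAmod_Frobenius_sum _ p_pr termA) _.
apply: eqAmod_sum => x; rewrite mulnC exprM.
by apply: eqAmod_Frobenius_lin; rewrite ?rpredX.
Qed.

(** * Decomposition of fundamental discriminants *)

Definition chi4 (n : int) : int :=
  if (n == 1 %[mod 4])%Z then 1 else if (n == 3 %[mod 4])%Z then -1 else 0.

Definition chi8 (n : int) : int :=
  if (n == 1 %[mod 8])%Z || (n == 7 %[mod 8])%Z then 1
  else if (n == 3 %[mod 8])%Z || (n == 5 %[mod 8])%Z then -1 else 0.

(** For d in {1, -4, 8, -8} this is the Kronecker symbol (d/n); the value 1 at any other d is a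
    filler. *)
Definition kappa (d n : int) : int :=
  if d == -4 then chi4 n else if d == 8 then chi8 n
  else if d == -8 then chi4 n * chi8 n else 1.

Lemma root_frobenius_N1 p : odd p -> root_frobenius p (-1) (chi4 p).
Proof.
move=> p_odd; exists 'i.
  apply: (@Aint_unity_root 4) => //.
  by rewrite unity_rootE -[4%N]/(2 * 2)%N exprM sqrCi sqrrN expr1n.
split; first by rewrite sqrCi rmorphN1.
have pE : p = (2 * p./2).+1 by lia.
have -> : 'i ^+ p = (-1) ^+ p./2 * 'i :> algC by rewrite {1}pE exprS exprM sqrCi mulrC.
suff -> : chi4 p = (-1) ^+ p./2 by rewrite rmorphXn /= rmorphN1 eqAmod_refl.
rewrite -signr_odd /chi4.
rewrite !modz_nat; case: (boolP (odd p./2)) => hp.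
  by have -> : (p %% 4 = 3)%N by lia.
by have -> : (p %% 4 = 1)%N by lia.
Qed.

Lemma root_frobenius_2 p : prime p -> odd p -> root_frobenius p 2 (chi8 p).
Proof.
move=> p_pr p_odd; have [z z_pr] := @C_prim_root_exists 8 isT.
have zA := Aint_prim_root z_pr; have z8 := prim_expr_order z_pr.
have z4 : z ^+ 4 = -1.
  have /eqP : (z ^+ 4) ^+ 2 = 1 by rewrite -exprM z8.
  by rewrite sqrf_eq1 -(prim_order_dvd z_pr) => /orP[|/eqP].
have z7A : z ^+ 7 \in Aint by rewrite rpredX.
(* This is z + 1/z, whose square z^2 + z^(-2) + 2 equals 2 because z^4 = -1. *)
exists (z + z ^+ 7); first by rewrite rpredD.
split.
  have -> : (z + z ^+ 7) ^+ 2 = z ^+ 2 * (1 + z ^+ 4 * z ^+ 8) + z ^+ 8 *+ 2 by ring.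
  by rewrite z8 z4 mulr1 subrr mulr0 add0r.
apply: eqAmod_trans (eqAmod_Frobenius p_pr zA z7A) _; rewrite -exprM.
suff -> : z ^+ p + z ^+ (7 * p) = (chi8 p)%:~R * (z + z ^+ 7) by exact: eqAmod_refl.
have zmod n : z ^+ n = z ^+ (n %% 8) by apply/eqP; rewrite (eq_prim_root_expr z_pr) modn_mod.
have z3 : z ^+ 3 = - z ^+ 7 by rewrite -[7%N]/(4 + 3)%N exprD z4; ring.
have z5 : z ^+ 5 = - z by rewrite -[5%N]/(4 + 1)%N exprD z4; ring.
rewrite (zmod p) (zmod (7 * p)%N).
have : [\/ p %% 8 = 1, p %% 8 = 3, p %% 8 = 5 | p %% 8 = 7]%N.
  have : (p %% 8 < 8)%N by rewrite ltn_mod.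
  have : odd (p %% 8) by lia.
  case: (p %% 8)%N => [|[|[|[|[|[|[|[|n]]]]]]]] //= _ _;
    by [exact: Or41|exact: Or42|exact: Or43|exact: Or44].
rewrite /chi8 !modz_nat -modnMmr.
by case=> -> //=; rewrite ?mulN1r ?mul1r ?expr1 ?z3 ?z5 ?mulrN1z //; ring.
Qed.

Lemma root_frobenius_kappa p d : prime p -> odd p -> d \in [:: 1; -4; 8; -8] ->
  root_frobenius p d (kappa d p).
Proof.
move=> p_pr p_odd.
have r1 : root_frobenius p 1 1.
  by exists 1; [exact: Aint1|rewrite !expr1n mul1r eqAmod_refl].
have r4 : root_frobenius p 4 1.
  exists 2; first exact: rpred_nat.
  split; first by rewrite -natrX.
  by rewrite mul1r; exact: (eqAmod_Fermat 2 p_pr).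
have rN1 := root_frobenius_N1 p_odd; have r2 := root_frobenius_2 p_pr p_odd.
rewrite !inE => /or4P[] /eqP -> //; rewrite /kappa /=.
- by have := root_frobeniusM r4 rN1; rewrite mul1r.
- by have := root_frobeniusM r4 r2; rewrite mul1r.
- by have := root_frobeniusM (root_frobeniusM r4 rN1) r2; rewrite mul1r.
Qed.

(* Comparing Frobenius on a square root of d with Euler's criterion for d. *)
Lemma root_frobenius_legendre q d e : prime q -> odd q -> ~~ (q%:Z %| d)%Z ->
  `|e| <= 1 -> root_frobenius q d e -> legendre d q = e.
Proof.
move=> q_pr q_odd qd e1 [g gA [gE gq]].
apply: (Fp_sign_inj q_pr q_odd) => //; first exact: legendre_norm.
have d0 : d%:~R != 0 :> 'F_q by rewrite -(dvdz_pcharf (pchar_Fp q_pr)).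
apply: (mulfI d0); rewrite -legendre_euler // -rmorphXn -[LHS]rmorphM -[RHS]rmorphM /=.
apply/eqP; rewrite Fp_intr_eq // -eqAmod_int ?prime_gt0 //.
have qE : q = (2 * q./2).+1 by lia.
have -> : (d * d ^+ q./2)%:~R = g * g ^+ q :> algC.
  by rewrite {2}qE exprS exprM mulrA -expr2 gE rmorphM rmorphXn.
have -> : (d * e)%:~R = g * (e%:~R * g) :> algC.
  by rewrite mulrCA -expr2 gE mulrC rmorphM.
by apply: eqAmodM; rewrite ?eqAmod_refl ?rpredM ?Aint_int.
Qed.

Lemma chi8_norm n : `|chi8 n| <= 1.
Proof. by rewrite /chi8; do ?case: ifP. Qed.

(** This supplementary law serves the prime p = 2, where the Gauss sum congruences, stated for odd
    p, give no value of the character. *)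
Lemma legendre_2 q : prime q -> odd q -> legendre 2 q = chi8 q.
Proof.
move=> q_pr q_odd; apply: root_frobenius_legendre => //; last exact: root_frobenius_2.
  by rewrite dvdzE /= dvdn_prime2 //; apply: contraTneq q_odd => ->.
exact: chi8_norm.
Qed.

Lemma prod_primes_squarefree m : (0 < m)%N ->
  (forall d, (d ^ 2 %| m)%N -> d = 1%N) -> (\prod_(q <- primes m) q)%N = m.
Proof.
move=> m0 sqf; rewrite [RHS](prod_prime_decomp m0) /primes big_map.
apply: eq_big_seq => -[q e] /mem_prime_decomp[q_pr e0 qe] /=.
case: e e0 qe => [|[|e]] // _ qe.
have q1 : q = 1%N by apply: sqf; apply: dvdn_trans qe; rewrite dvdn_exp2l.
by rewrite q1 in q_pr.
Qed.

Definition qstar (q : nat) : int := legendre (-1) q * q%:Z.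

Lemma qstar_mod4 q : prime q -> odd q -> (qstar q = 1 %[mod 4])%Z.
Proof.
move=> q_pr q_odd; rewrite /qstar legendre_sign // -signr_odd.
case: (boolP (odd q./2)) => hq; first by rewrite expr1 mulN1r; lia.
by rewrite expr0 mul1r; lia.
Qed.

Lemma qstar_abs q : prime q -> odd q -> `|qstar q|%N = q.
Proof. by move=> q_pr q_odd; rewrite /qstar legendre_sign // abszMsign. Qed.

(** An odd integer is determined by its absolute value and its class modulo 4. The two conclusions
    therefore fix the sign of the product when it is compared with D. *)
Lemma prod_qstar m : (0 < m)%N -> odd m -> (forall d, (d ^ 2 %| m)%N -> d = 1%N) ->
  absz (\prod_(q <- primes m) qstar q) = m /\
  (\prod_(q <- primes m) qstar q = 1 %[mod 4])%Z.
Proof.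
move=> m0 m_odd sqf.
have q_odd q : q \in primes m -> odd q.
  by rewrite mem_primes => /and3P[_ _ /dvdn_odd]; apply.
have q_pr q : q \in primes m -> prime q by rewrite mem_primes => /andP[].
split.
  rewrite -[RHS](prod_primes_squarefree m0 sqf) (big_morph absz abszM (erefl : absz 1 = 1%N)).
  by apply: eq_big_seq => q qm; rewrite qstar_abs ?q_odd ?q_pr.
move: q_odd q_pr; elim: (primes m) => [|q r IHr] q_odd q_pr; first by rewrite big_nil.
rewrite big_cons -modzMm IHr => [|x xr|x xr].
- by rewrite qstar_mod4 ?q_odd ?q_pr ?mem_head.
- by rewrite q_odd // inE xr orbT.
- by rewrite q_pr // inE xr orbT.
Qed.

Lemma largest_odd_divisorE D k m : odd m -> `|D|%N = (2 ^ k * m)%N ->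
  largest_odd_divisor D = m.
Proof.
move=> m_odd DE; rewrite /largest_odd_divisor DE.
have m0 : (0 < m)%N by case: m m_odd {DE}.
apply/eqP; rewrite eqn_leq; apply/andP; split.
  apply/bigmax_leqP_seq => d; rewrite -dvdn_divisors ?muln_gt0 ?expn_gt0 ?m0 // => dm d_odd.
  by apply: dvdn_leq => //; rewrite -(@Gauss_dvdr _ (2 ^ k)) // coprimeXr // coprimen2.
apply: (@leq_bigmax_seq _ _ _ id m) => //.
by rewrite -dvdn_divisors ?muln_gt0 ?expn_gt0 ?m0 // dvdn_mull.
Qed.

(** The sign is dictated by the cofactor, which must be 1 modulo 4 as a product of q*: D = 4 m with
    m = 3 mod 4 needs -4, and D = 8 m' needs 8 or -8 according as m' is 1 or 3 modulo 4. For a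
    fundamental D the last branch is D = 24 mod 32. *)
Definition two_part (D : int) : int :=
  if ~~ (2 %| D)%Z then 1 else if (D == 4 %[mod 8])%Z then -4
  else if (D == 8 %[mod 32])%Z then 8 else -8.

Definition prime_star_product (D : int) : int :=
  \prod_(q <- primes (largest_odd_divisor D)) qstar q.

Lemma fundamental_discriminantE D : fundamental_discriminant D ->
  D = two_part D * prime_star_product D /\
  `|D|%N = (`|two_part D| * largest_odd_divisor D)%N /\
  odd (largest_odd_divisor D).
Proof.
move=> [_ [[D1 sqf]|[m [DE m4 sqf]]]].
  have D_odd : odd `|D|%N by lia.
  have lod : largest_odd_divisor D = `|D|%N by apply: (@largest_odd_divisorE _ 0) => //; rewrite mul1n.
  have sqf' d : (d ^ 2 %| `|D|)%N -> d = 1%N by move=> ?; apply: sqf; rewrite dvdzE abszX.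
  have t1 : two_part D = 1 by rewrite /two_part; have -> : (2 %| D)%Z = false by lia.
  have [|PD P1] := prod_qstar _ D_odd sqf'; first by lia.
  rewrite t1 lod mul1r mul1n /prime_star_product lod; split=> //.
  by move: (\prod_(_ <- _) _) PD P1 => P; lia.
have sqf' d : (d ^ 2 %| `|m|)%N -> d = 1%N by move=> ?; apply: sqf; rewrite dvdzE abszX.
case: m4 => m4.
  have [m' mE] : exists m', m = 2 * m' by exists (m %/ 2)%Z; lia.
  have m'_odd : odd `|m'|%N by lia.
  have lod : largest_odd_divisor D = `|m'|%N.
    by apply: (@largest_odd_divisorE _ 3) => //; lia.
  have sqf2 d : (d ^ 2 %| `|m'|)%N -> d = 1%N.
    by move=> dm; apply: sqf'; rewrite mE abszM dvdn_mull.
  have [|PD P1] := prod_qstar _ m'_odd sqf2; first by lia.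
  rewrite /prime_star_product lod; move: (\prod_(_ <- _) _) PD P1 => P PD P1.
  rewrite /two_part; have -> : (2 %| D)%Z by lia.
  have -> : (D == 4 %[mod 8])%Z = false by lia.
  by case: eqP => D32 /=; split; lia.
have m_odd : odd `|m|%N by lia.
have lod : largest_odd_divisor D = `|m|%N.
  by apply: (@largest_odd_divisorE _ 2) => //; lia.
have [|PD P1] := prod_qstar _ m_odd sqf'; first by lia.
rewrite /prime_star_product lod; move: (\prod_(_ <- _) _) PD P1 => P PD P1.
rewrite /two_part; have -> : (2 %| D)%Z by lia.
have -> : (D == 4 %[mod 8])%Z by lia.
have mP : m = - P by lia.
by rewrite /= DE mP; split; [ring|split=> //; lia].
Qed.

Lemma two_part_mem D : two_part D \in [:: 1; -4; 8; -8].
Proof. by rewrite /two_part; do ?case: ifP. Qed.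

(* For a prime n not dividing D, this is the Kronecker symbol (D/n). *)
Definition quad_char (D n : int) : int :=
  kappa (two_part D) n * \prod_(q <- primes (largest_odd_divisor D)) legendre n q.

Lemma kappa_sqr d n : d \in [:: 1; -4; 8; -8] ->
  kappa d n ^+ 2 = (coprimez n d : nat)%:Z.
Proof.
have cop2 k : coprimez n (2 ^+ k.+1) = odd `|n|%N.
  by rewrite coprimez_pexpr // coprimezE coprimen2.
have sq4 : chi4 n ^+ 2 = (odd `|n|%N : nat)%:Z.
  by rewrite /chi4; case: (boolP (odd _)) => n2; do ?case: ifP => //; lia.
have sq8 : chi8 n ^+ 2 = (odd `|n|%N : nat)%:Z.
  by rewrite /chi8; case: (boolP (odd _)) => n2; do ?case: ifP => //; lia.
rewrite !inE => /or4P[] /eqP -> ; rewrite /kappa /= ?coprimezN.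
- by rewrite coprimezE coprimen1.
- by rewrite (cop2 1%N).
- by rewrite (cop2 2%N).
- by rewrite exprMn sq4 sq8 (cop2 2%N); case: (odd _).
Qed.

Lemma prod_legendre_sqr (r : seq nat) n : all prime r ->
  (\prod_(q <- r) legendre n q) ^+ 2 = (coprime `|n|%N (\prod_(q <- r) q) : nat)%:Z.
Proof.
elim: r => [|q r IHr] /=; first by rewrite !big_nil coprimen1.
move=> /andP[q_pr r_pr]; rewrite !big_cons exprMn IHr // legendre_sqr // coprimeMr.
by rewrite -[n \in dvdz q]/(q %| `|n|)%N -prime_coprime // coprime_sym -PoszM mulnb.
Qed.

Lemma all_prime_primes m : all prime (primes m).
Proof. by apply/allP => q; rewrite mem_primes => /andP[]. Qed.

(** Taking absolute values in the factorization of D and cancelling [two_part D] gives this without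
    going back to squarefreeness. *)
Lemma prod_primes_lod D : fundamental_discriminant D ->
  (\prod_(q <- primes (largest_odd_divisor D)) q)%N = largest_odd_divisor D.
Proof.
move=> hD; have [DE [Dabs lod_odd]] := fundamental_discriminantE hD.
have tp0 : (0 < `|two_part D|)%N.
  by have := two_part_mem D; rewrite !inE => /or4P[] /eqP ->.
apply/eqP; rewrite -(eqn_pmul2l tp0) -Dabs [in X in _ == X]DE abszM; apply/eqP.
congr (_ * _)%N; apply: esym.
rewrite /prime_star_product (big_morph absz abszM (erefl : absz 1 = 1%N)).
apply: eq_big_seq => q; rewrite mem_primes => /and3P[q_pr _ qD].
by rewrite qstar_abs // (dvdn_odd qD).
Qed.

(** Used twice: to see that the character is a sign on integers prime to D, and to count admissible
    residues by a sum that factors. *)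
Lemma quad_char_sqr D n : fundamental_discriminant D ->
  quad_char D n ^+ 2 = (coprimez n D : nat)%:Z.
Proof.
move=> hD; have [DE [Dabs lod_odd]] := fundamental_discriminantE hD.
rewrite /quad_char exprMn kappa_sqr ?two_part_mem // prod_legendre_sqr ?all_prime_primes //.
rewrite prod_primes_lod // -PoszM mulnb; congr (Posz (nat_of_bool _)).
by rewrite !coprimezE Dabs coprimeMr.
Qed.

Lemma quad_char_sign D n : fundamental_discriminant D -> coprimez n D ->
  quad_char D n = 1 \/ quad_char D n = -1.
Proof.
move=> hD nD; have /eqP := quad_char_sqr n hD; rewrite nD sqrf_eq1.
by case/orP => /eqP; [left|right].
Qed.

Lemma root_frobenius_disc D p : fundamental_discriminant D -> prime p -> odd p ->
  coprimez p D -> root_frobenius p D (quad_char D p).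
Proof.
move=> hD p_pr p_odd pD; have [DE [Dabs lod_odd]] := fundamental_discriminantE hD.
rewrite [in X in root_frobenius p X]DE; apply: root_frobeniusM.
  exact: root_frobenius_kappa (two_part_mem D).
have p_lod : ~~ (p %| largest_odd_divisor D)%N.
  apply: contraL pD => plod; rewrite coprimezE prime_coprime //.
  by rewrite negbK Dabs dvdn_mull.
have H q : q \in primes (largest_odd_divisor D) -> [/\ prime q, odd q & p != q].
  rewrite mem_primes => /and3P[q_pr _ qD]; split => //; first exact: dvdn_odd lod_odd.
  by apply: contraNneq p_lod => ->.
rewrite /prime_star_product; elim: (primes _) H => [|q r IHr] H.
  by rewrite !big_nil; apply: root_frobenius_kappa (mem_head _ _).
rewrite !big_cons; have [q_pr q_odd pq] := H q (mem_head _ _).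
apply: root_frobeniusM; first exact: root_frobenius_prime.
by apply: IHr => x xr; apply: H; rewrite inE xr orbT.
Qed.

(** Both data are multiplicative in the primes q dividing D: q* is 1 or 5 modulo 8 according as
    (2/q) is 1 or -1, and 5 * 5 = 1 modulo 8. *)
Lemma quad_char_2 D : fundamental_discriminant D -> coprimez 2 D ->
  (D = 1 %[mod 8])%Z /\ quad_char D 2 = 1 \/ (D = 5 %[mod 8])%Z /\ quad_char D 2 = -1.
Proof.
move=> hD D2; have [DE [Dabs lod_odd]] := fundamental_discriminantE hD.
have tp1 : two_part D = 1.
  rewrite /two_part; case: ifPn => // /negbNE D2'; move: D2.
  by rewrite coprimezE coprime2n; lia.
rewrite [in X in (X = 1 %[mod _])%Z]DE [in X in (X = 5 %[mod _])%Z]DE.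
rewrite /quad_char tp1 !mul1r /prime_star_product.
have H q : q \in primes (largest_odd_divisor D) -> prime q /\ odd q.
  rewrite mem_primes => /and3P[q_pr _ qD]; split => //; exact: dvdn_odd lod_odd.
elim: (primes _) H => [|q r IHr] H; first by rewrite !big_nil; left.
rewrite !big_cons; have [q_pr q_odd] := H q (mem_head _ _).
have {}IHr := IHr (fun x xr => H x (@mem_behead _ (q :: r) x xr)).
have qs4 := qstar_mod4 q_pr q_odd.
have qsq : qstar q = q \/ qstar q = - q%:Z by have := qstar_abs q_pr q_odd; lia.
have hq : (qstar q = 1 %[mod 8])%Z /\ legendre 2 q = 1 \/
          (qstar q = 5 %[mod 8])%Z /\ legendre 2 q = -1.
  rewrite legendre_2 // /chi8 !modz_nat; move: (qstar q) qs4 qsq => x x4 xq.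
  have : (q %% 8 = 1 \/ q %% 8 = 3 \/ q %% 8 = 5 \/ q %% 8 = 7)%N by lia.
  by case=> [|[|[|]]] q8; rewrite q8 /=; [left|right|right|left]; split => //; lia.
by rewrite -(modzMml (qstar q)) -(modzMmr _ (\prod_(_ <- r) _));
  case: hq => -[-> ->]; case: IHr => -[-> ->]; rewrite ?mulr1 ?mul1r ?mulrNN;
  [left|right|right|left].
Qed.

(** * Inert primes *)

Lemma root_quadratic_Aint (x : algC) (m n : int) :
  x ^+ 2 = m%:~R * x + n%:~R -> x \in Aint.
Proof.
move=> xE; apply: (@root_monic_Aint ('X^2 - (m%:~R *: 'X + n%:~R%:P))).
- by rewrite rootE !hornerE xE subrr.
- rewrite monicE lead_coefDl ?lead_coefXn // size_polyXn size_polyN.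
  apply: leq_ltn_trans (size_polyD _ _) _; rewrite gtn_max.
  rewrite (leq_ltn_trans (size_scale_leq _ _)) ?size_polyX //.
  by rewrite (leq_ltn_trans (size_polyC_leq1 _)).
- apply/polyOverP=> i; rewrite coefB coefD coefZ coefXn coefX coefC -mulrb.
  by rewrite rpredB ?rpred_nat // rpredD ?rpredMn ?rpredM ?rpred_int ?rpred_nat.
Qed.

(** The number k is the norm of (D + sqrt D)/2, a root of X^2 - D X + k, which is therefore integral
    for every D. *)
Lemma fundamental_discriminant_mod4 D : fundamental_discriminant D ->
  exists k, D ^+ 2 - D = 4 * k.
Proof.
move=> [_ [[D1 _]|[m [-> _ _]]]].
  have [k ->] : exists k, D = 4 * k + 1 by exists (D %/ 4)%Z; lia.
  by exists (4 * k ^+ 2 + k); ring.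
by exists (4 * m ^+ 2 - m); ring.
Qed.

Lemma fundamental_discriminant_nonsquare D (k : int) :
  fundamental_discriminant D -> k ^+ 2 <> D.
Proof.
move=> [D1 [[_ sqf]|[m [DE m4 sqf]]]] kD.
  have : `|k|%N = 1%N by apply: sqf; rewrite -kD dvdzE !abszX dvdnn.
  by move=> k1; apply: D1; rewrite -kD; have [->|->] : k = 1 \/ k = -1 by lia.
have [j kE] : exists j, k = 2 * j by exists (k %/ 2)%Z; nia.
have mE : m = j ^+ 2 by nia.
have : `|j|%N = 1%N by apply: sqf; rewrite mE dvdzE !abszX dvdnn.
move=> j1; have m1 : m = 1 by rewrite mE; have [->|->] : j = 1 \/ j = -1 by lia.
by move: m4; rewrite m1; lia.
Qed.

(** * Conjugation and integrality in the quadratic field *)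

Section QuadraticField.
Variables (D : int) (hD : fundamental_discriminant D).

Local Notation s := (sqrtC D%:~R : algC).

Definition quad (a b : rat) : algC := ratr a + ratr b * s.

Lemma sqrt_discE : s ^+ 2 = D%:~R. Proof. exact: sqrtCK. Qed.

Lemma sqrt_disc_Aint : s \in Aint.
Proof. by apply: (@root_quadratic_Aint _ 0 D); rewrite sqrt_discE mul0r add0r. Qed.

Lemma rat_Aint_int (a : rat) : (ratr a : algC) \in Aint -> exists k : int, a = k%:~R.
Proof.
move=> aA; have /intrP[k kE] : (ratr a : algC) \is a Num.int.
  by apply: Cint_rat_Aint => //; exact: Crat_rat.
by exists k; apply: (@fmorph_inj _ algC ratr); rewrite /= kE ratr_int.
Qed.

Lemma disc_rat_nonsquare (r : rat) : r ^+ 2 <> D%:~R.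
Proof.
move=> rD; have [k kE] : exists k : int, r = k%:~R.
  apply: rat_Aint_int; apply: (@root_quadratic_Aint _ 0 D).
  by rewrite mul0r add0r -rmorphXn rD rmorph_int.
apply: (@fundamental_discriminant_nonsquare D k hD).
by apply: (@intr_inj rat); rewrite rmorphXn /= -kE.
Qed.

Lemma quad_eq0 a b : quad a b = 0 -> a = 0 /\ b = 0.
Proof.
move=> ab0; have [b0|b0] := eqVneq b 0.
  split=> //; move: ab0; rewrite /quad b0 rmorph0 mul0r addr0 => /eqP.
  by rewrite fmorph_eq0 => /eqP.
case: (@disc_rat_nonsquare (- a / b)); apply: (@fmorph_inj _ algC ratr).
have b0' : ratr b != 0 :> algC by rewrite fmorph_eq0.
rewrite rmorphXn fmorph_div rmorphN rmorph_int -sqrt_discE.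
congr (_ ^+ 2); apply: (mulIf b0'); rewrite divfK // mulrC.
by apply/eqP; rewrite eq_sym -addr_eq0 addrC; exact/eqP.
Qed.

Lemma quadM a b a' b' :
  quad a b * quad a' b' = quad (a * a' + b * b' * D%:~R) (a * b' + b * a').
Proof.
rewrite /quad !(rmorphD, rmorphM) /= ratr_int.
by have := sqrt_discE; move: s => t; move: (D%:~R : algC) => d <-; ring.
Qed.

Lemma quadD a b a' b' : quad a b + quad a' b' = quad (a + a') (b + b').
Proof. rewrite /quad !rmorphD /=; ring. Qed.

(** Rational polynomials commute with the conjugation b -> -b. This suffices to compare minimal
    polynomials without an automorphism of [algC]. *)
Lemma conj_horner (p : {poly rat}) a b : exists u v,
  (map_poly ratr p).[quad a b] = quad u v /\ (map_poly ratr p).[quad a (- b)] = quad u (- v).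
Proof.
elim/poly_ind: p => [|p c [u [v [uv uvN]]]].
  by exists 0, 0; rewrite rmorph0 !horner0 oppr0 /quad rmorph0 mul0r addr0.
exists (u * a + v * b * D%:~R + c), (u * b + v * a).
rewrite !(rmorphD, rmorphM) /= map_polyX map_polyC !hornerE uv uvN !quadM.
have cE : ratr c = quad c 0 by rewrite /quad rmorph0 mul0r addr0.
rewrite /= cE !quadD; split; congr quad; ring.
Qed.

(** The minimal polynomial vanishes at [quad a b]; by independence of 1 and sqrt D both coordinates
    of its value are 0, so it vanishes at the conjugate as well. *)
Lemma conj_Aint a b : quad a b \in Aint -> quad a (- b) \in Aint.
Proof.
move=> abA; have [p [pE p_mon] _] := minCpolyP (quad a b).
apply: (@root_monic_Aint (minCpoly (quad a b))) => //; last exact: minCpoly_monic.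
have [u [v [uv uvN]]] := conj_horner p a b.
have := root_minCpoly (quad a b); rewrite pE !rootE uv uvN => /eqP /quad_eq0[-> ->].
by rewrite oppr0 /quad rmorph0 mul0r addr0.
Qed.

(* The trace [2 a] and the square [(2 b)^2 D] of the difference of the conjugates are
   integers; hence so is [(2 b D)^2], although [2 b] need not be an integer. *)
Lemma quad_Aint_coef a b : quad a b \in Aint ->
  exists A B : int, a * 2 = A%:~R /\ b * 2 * D%:~R = B%:~R.
Proof.
move=> abA; have abA' := conj_Aint abA.
have [A AE] : exists A : int, a * 2 = A%:~R.
  apply: rat_Aint_int; have -> : ratr (a * 2) = quad a b + quad a (- b).
    rewrite quadD subrr mulr_natr mulr2n /quad rmorph0; ring.
  exact: rpredD.
exists A; suff [B BE] : exists B : int, b * 2 * D%:~R = B%:~R by exists B.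
have [n nE] : exists n : int, (b * 2) ^+ 2 * D%:~R = n%:~R.
  apply: rat_Aint_int; have -> : ratr ((b * 2) ^+ 2 * D%:~R) = (quad a b - quad a (- b)) ^+ 2.
    rewrite rmorphM rmorphXn rmorphM /= ratr_int /quad rmorphN /= ratr_nat.
    by have := sqrt_discE; move: s => t; move: (D%:~R : algC) => d <-; ring.
  by rewrite rpredX ?rpredB.
apply: rat_Aint_int; apply: (@root_quadratic_Aint _ 0 (n * D)).
rewrite mul0r add0r -rmorphXn.
have -> : (b * 2 * D%:~R) ^+ 2 = (n * D)%:~R by rewrite exprMn expr2 mulrA nE rmorphM.
by rewrite rmorph_int.
Qed.

End QuadraticField.

(** * The p-th power map on quadratic integers *)

Section Inert.
Variables (D : int) (hD : fundamental_discriminant D) (p : nat).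
Hypotheses (p_pr : prime p) (pD : coprimez p D).

Local Notation s := (sqrtC D%:~R : algC).
Local Notation quad := (quad D).

Let p0 : (0 < p)%N := prime_gt0 p_pr.

(** Modulo p the p-th power is additive and fixes integers, so its effect on W determines its effect
    on c y = A + B W; then c is cancelled. *)
Lemma Frobenius_transfer (c A B : int) y y' W W' :
  coprimez c p -> y \in Aint -> y' \in Aint -> W \in Aint -> W' \in Aint ->
  (W ^+ p == W' %[mod p])%A ->
  c%:~R * y = A%:~R + B%:~R * W -> c%:~R * y' = A%:~R + B%:~R * W' ->
  (y ^+ p == y' %[mod p])%A.
Proof.
move=> cp yA y'A WA W'A Wp cy cy'.
apply: (@dvdA_Gauss p c) => //; first by rewrite rpredB ?rpredX.
rewrite mulrBr; apply: (@eqAmod_trans _ ((c%:~R * y) ^+ p)).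
  by rewrite eqAmod_sym; exact: eqAmod_Frobenius_lin.
rewrite cy cy'; apply: eqAmod_trans (eqAmod_Frobenius p_pr _ _) _.
- exact: Aint_int.
- by rewrite rpredM ?Aint_int.
apply: eqAmodD; first exact: eqAmod_Fermat.
apply: eqAmod_trans (eqAmod_Frobenius_lin _ p_pr WA) _.
by apply: eqAmodM; rewrite ?eqAmod_refl ?rpredX ?Aint_int.
Qed.

Lemma sqrt_disc_Frobenius : odd p ->
  (s ^+ p == (quad_char D p)%:~R * s %[mod p])%A.
Proof.
move=> p_odd; have [g gA [gE gp]] := root_frobenius_disc hD p_pr p_odd pD.
have /eqP : s ^+ 2 = g ^+ 2 by rewrite sqrt_discE gE.
rewrite eqf_sqr => /orP[] /eqP ->; first by [].
have p_odd' : odd p = true by [].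
by rewrite exprNn -signr_odd p_odd' expr1 mulN1r mulrN eqAmodN opprK.
Qed.

Lemma quad_Frobenius (a b : rat) : quad a b \in Aint ->
  (quad a b ^+ p == quad a ((quad_char D p)%:~R * b) %[mod p])%A.
Proof.
move=> abA; have e1 := quad_char_sign hD pD.
have [A [B [AE BE]]] := quad_Aint_coef hD abA.
have yA' : quad a ((quad_char D p)%:~R * b) \in Aint.
  by case: e1 => ->; rewrite ?mul1r // mulN1r; exact: conj_Aint.
have AE' : ratr a * 2 = A%:~R :> algC by rewrite -[2](ratr_nat _ 2) -rmorphM AE /= ratr_int.
have BE' : ratr b * 2 * D%:~R = B%:~R :> algC.
  by rewrite -[2](ratr_nat _ 2) -(ratr_int _ D) -!rmorphM BE /= ratr_int.
have sA := sqrt_disc_Aint D.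
have [p_odd|p_even] := boolP (odd p).
  (* Since A = 2 a and B = 2 b D, the element y = a + b sqrt D satisfies 2 D y = D A + B sqrt D, and
     2 D is prime to the odd prime p. *)
  apply: (@Frobenius_transfer (2 * D) (D * A) B _ _ s) (sqrt_disc_Frobenius p_odd) _ _ => //.
  - by rewrite coprimez_sym coprimezMr pD andbT coprimezE coprimen2.
  - by rewrite rpredM ?Aint_int.
  - rewrite /Defs.quadratic_field /quad !rmorphM /= -AE' -BE'; ring.
  - rewrite /quad !rmorphM /= ratr_int -AE' -BE'; ring.
have p2 : p = 2%N by have := even_prime p_pr; case=> // p_odd; rewrite p_odd in p_even.
have cop2 : coprimez 2 D by move: pD; rewrite p2.
have D8 := quad_char_2 hD cop2.
have [k DE] : exists k, D = 4 * k + 1.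
  by case: D8 => -[D8 _]; exists (D %/ 4)%Z; lia.
have s2 : s ^+ 2 = 4 * k%:~R + 1 by rewrite sqrt_discE DE rmorphD rmorphM.
have two0 : 2 != 0 :> algC by rewrite pnatr_eq0.
(* The factor 2 cannot be cancelled modulo 2, so the denominator is absorbed into w, which is
   integral because D = 4 k + 1. *)
pose w : algC := (1 + s) / 2.
have w2 : w ^+ 2 = 1%:~R * w + k%:~R.
  rewrite /w; move: s2; move: s k%:~R => t c t2.
  have -> : ((1 + t) / 2) ^+ 2 = (1 + 2 * t + t ^+ 2) / 4 by field.
  by rewrite t2 mul1r; field.
have wA : w \in Aint := root_quadratic_Aint w2.
pose w' : algC := (1 + (quad_char D p)%:~R * s) / 2.
have yE : D%:~R * quad a b - B%:~R * w = (D * A - B)%:~R / 2.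
  by rewrite /quad /w rmorphB rmorphM /= -AE' -BE'; field.
(* The half of D A - B is the algebraic integer D y - B w, and it is rational. *)
have /dvdzP[E EE] : (2%:Z %| D * A - B)%Z.
  rewrite -dvdA_int // dvdA_natE // -yE.
  by apply: rpredB; apply: rpredM => //; exact: Aint_int.
have EE' : E%:~R = (D * A - B)%:~R / 2 :> algC by rewrite EE rmorphM /= mulfK.
have w'E : w' = w /\ (D = 1 %[mod 8])%Z \/ w' = 1 - w /\ (D = 5 %[mod 8])%Z.
  by rewrite /w' p2; case: D8 => -[D8 ->]; [left|right]; split=> //; rewrite /w; field.
have w'A : w' \in Aint by case: w'E => -[-> _]; rewrite ?rpredB ?Aint1.
apply: (@Frobenius_transfer D E B _ _ w w') => //.
- by rewrite coprimez_sym.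
(* Here w^2 = w + k. If D = 1 mod 8 then k is even and w^2 is congruent to w; if D = 5 mod 8 then k
   is odd and w^2 is congruent to the conjugate 1 - w. *)
- rewrite p2 w2 mul1r; case: w'E => -[-> D8'].
    rewrite -[X in (_ == X %[mod _])%A]addr0 eqAmodDl -[0]/(0%:~R) eqAmod_int //.
    by rewrite eqz_mod_dvd subr0; lia.
  rewrite /eqAmod; have -> : w + k%:~R - (1 - w) = (k - 1)%:~R + 2%:~R * w.
    by rewrite rmorphB /=; ring.
  rewrite rpredD ?dvdA_int //; first by lia.
  by rewrite mulrC; apply: dvdA_mulr => //; rewrite dvdA_int.
- by rewrite EE' -yE subrK.
- by rewrite EE' /w' /quad rmorphB !rmorphM /= ratr_int -AE' -BE'; field.
Qed.
End Inert.

(** * Inertness read from the p-th power map *)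

Lemma horner_int_dvdA (p : nat) (P : {poly int}) y : (0 < p)%N -> y \in Aint ->
  (forall i, (p%:Z %| P`_i)%Z) -> (p %| (map_poly intr P).[y])%A.
Proof.
move=> p0 yA Pp; rewrite horner_coef; apply: rpred_sum => i _.
by rewrite coef_map mulrC; apply: dvdA_mulr; rewrite ?rpredX // dvdA_int.
Qed.

(** Over ['F_p] the polynomial X^p - X is the product of all X - i. The two integral polynomials
    thus differ by one with coefficients divisible by p, which is evaluated at y. *)
Lemma prod_shift_Frobenius (p : nat) y : prime p -> y \in Aint ->
  (\prod_(i < p) (y - i%:R) == y ^+ p - y %[mod p])%A.
Proof.
move=> p_pr yA.
pose P : {poly int} := \prod_(i < p) ('X - (i%:R)%:P) - ('X^p - 'X).
have -> : \prod_(i < p) (y - i%:R) = (map_poly intr (\prod_(i < p) ('X - (i%:R)%:P) : {poly int})).[y].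
  rewrite rmorph_prod horner_prod; apply: eq_bigr => i _.
  by rewrite rmorphB /= map_polyX map_polyC !hornerE /= rmorph_nat.
have -> : y ^+ p - y = (map_poly intr ('X^p - 'X : {poly int})).[y].
  by rewrite rmorphB /= map_polyXn map_polyX !hornerE.
rewrite /eqAmod -hornerN -hornerD -rmorphB /=.
apply: horner_int_dvdA => //; first exact: prime_gt0.
move=> i; rewrite (dvdz_pcharf (pchar_Fp p_pr)) -coef_map rmorphB /=.
suff -> : map_poly intr (\prod_(i < p) ('X - (i%:R)%:P)) = map_poly intr ('X^p - 'X) :> {poly 'F_p}.
  by rewrite subrr coef0.
rewrite rmorphB /= map_polyXn map_polyX -[X in 'X^X](card_Fp p_pr) finField_genPoly.
pose F (i : nat) : {poly 'F_p} := map_poly intr ('X - (i%:R)%:P).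
rewrite rmorph_prod -(big_mkord xpredT F).
rewrite (congr1 (fun n => \prod_(0 <= i < n) F i) (esym (Fp_cast p_pr))) big_mkord.
by apply: eq_bigr => x _; rewrite /F rmorphB /= map_polyX map_polyC /= rmorph_nat natr_Zp.
Qed.

Section InertCriterion.
Variables (D : int) (hD : fundamental_discriminant D).
Local Notation s := (sqrtC D%:~R : algC).
Local Notation quad := (quad D).

Lemma quadratic_integerM x y :
  quadratic_integer D x -> quadratic_integer D y -> quadratic_integer D (x * y).
Proof.
move=> [[a [b ->]] xA] [[a' [b' ->]] yA]; split; last exact: rpredM.
by do 2!eexists; rewrite -!/(quad _ _) quadM.
Qed.

Lemma quadratic_integer_int (k : int) : quadratic_integer D k%:~R.
Proof.
split; last exact: Aint_int.
by exists k%:~R, 0; rewrite rmorph0 mul0r addr0 ratr_int.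
Qed.

(** Dividing by p does not leave the field, so membership in the ideal can be tested among all
    algebraic integers, where the congruences live. *)
Lemma principal_idealE p z : (0 < p)%N -> quadratic_integer D z ->
  principal_ideal D p z <-> (p %| z)%A.
Proof.
move=> p0 [[a [b zE]] zA]; have p0' : p%:R != 0 :> algC by rewrite pnatr_eq0 -lt0n.
rewrite dvdA_natE //; split=> [[y [_ yA] ->]|zp]; first by rewrite mulrC mulKf.
exists (z / p%:R); last by rewrite mulrC divfK.
split=> //; exists (a / p%:R), (b / p%:R).
by rewrite !fmorph_div !rmorph_nat zE; field.
Qed.

(** If chi(p) = 1, the p-th power fixes y modulo p, so p divides the product of the y - i over i <
    p, but none of the factors for a suitable y. If chi(p) = -1, it acts as conjugation, so y^(p+1)
    is congruent to the norm of y and primality reduces to that of p in Z. *)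
Lemma inert_quad_char p : prime p -> coprimez p D ->
  inert D p <-> quad_char D p = -1.
Proof.
move=> p_pr pD; have p0 := prime_gt0 p_pr.
have one_notin : ~ principal_ideal D p 1.
  move/(principal_idealE p0 (quadratic_integer_int 1)).
  rewrite (dvdA_int 1 p0) dvdz1 => /eqP p1.
  by move: p_pr; rewrite -[p]/(`|p%:Z|%N) p1.
have frob a b := quad_Frobenius hD p_pr pD (a := a) (b := b).
split=> [[_ p_prime]|eN1].
  case: (quad_char_sign hD pD) => // e1; exfalso.
  have [k kE] := fundamental_discriminant_mod4 hD.
  (* The coefficient 1/2 makes the difference of y - i and its conjugate equal to sqrt D rather than
     2 sqrt D, so that p = 2 is covered too. *)
  pose y := quad (D%:~R / 2) (1 / 2).
  have yA : y \in Aint.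
    apply: (@root_quadratic_Aint _ D (- k)).
    have D2 : D%:~R ^+ 2 = 4 * k%:~R + D%:~R :> algC.
      by rewrite -rmorphXn /= -[X in X%:~R](subrK D) kE rmorphD rmorphM.
    rewrite /y /quad !fmorph_div /= ratr_int ratr_nat rmorph1.
    have := sqrt_discE D; move: s D2 => t; rewrite rmorphN /=.
    move: (D%:~R : algC) (k%:~R : algC) => d c d2 t2.
    have -> : (d / 2 + 1 / 2 * t) ^+ 2 = (d ^+ 2 + 2 * d * t + t ^+ 2) / 4 by field.
    have cE : c = (d ^+ 2 - d) / 4 by rewrite d2; field.
    by rewrite t2 cE; field.
  have yp : (p %| y ^+ p - y)%A.
    by have := frob _ _ yA; rewrite e1 mul1r.
  have shiftE (i : nat) : y - i%:R = quad (D%:~R / 2 - i%:R) (1 / 2).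
    by rewrite /y /quad rmorphB /= ratr_nat; ring.
  have shiftO (i : nat) : quadratic_integer D (y - i%:R).
    by split; [rewrite shiftE; do 2!eexists|rewrite rpredB ?rpred_nat].
  have prodO (r : seq nat) : quadratic_integer D (\prod_(i <- r) (y - i%:R)).
    elim: r => [|i r IHr]; first by rewrite big_nil; exact: (quadratic_integer_int 1).
    by rewrite big_cons; exact: quadratic_integerM.
  have prodN (r : seq nat) : (forall i : nat, ~ principal_ideal D p (y - i%:R)) ->
      ~ principal_ideal D p (\prod_(i <- r) (y - i%:R)).
    move=> Hi; elim: r => [|i r IHr]; first by rewrite big_nil.
    by rewrite big_cons => /(p_prime _ _ (shiftO i) (prodO r))[/Hi|].
  apply: (prodN (iota 0 p)) => [i /(principal_idealE p0 (shiftO i))|].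
    rewrite dvdA_natE // shiftE => yiA.
    have qE (c : rat) : quad (D%:~R / 2 - i%:R) c / p%:R = quad ((D%:~R / 2 - i%:R) / p%:R) (c / p%:R).
      have p0' : p%:R != 0 :> algC by rewrite pnatr_eq0 -lt0n.
      by rewrite /quad !fmorph_div !rmorph_nat; field.
    move: (yiA); rewrite qE => /(conj_Aint hD); rewrite -mulNr -qE => yiA'.
    (* If p divided y - i it would divide the conjugate, hence their difference sqrt D, hence D. *)
    have : (p %| s)%A.
      rewrite dvdA_natE //.
      have -> : s / p%:R = quad (D%:~R / 2 - i%:R) (1 / 2) / p%:R
                         - quad (D%:~R / 2 - i%:R) (- (1 / 2)) / p%:R.
        rewrite -mulrBl; congr (_ / _).
        by rewrite /quad rmorphN fmorph_div /= rmorph1 ratr_nat; field.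
      exact: rpredB.
    move/(dvdA_mulr (sqrt_disc_Aint D)); rewrite -expr2 sqrt_discE dvdA_int // => pDv.
    by move: pD; rewrite coprimezE prime_coprime // -[(_ %| _)%N]/(p%:Z %| D)%Z pDv.
  apply/(principal_idealE p0 (prodO _)).
  have := prod_shift_Frobenius p_pr yA.
  by rewrite -(big_mkord xpredT (fun i => y - i%:R)) /index_iota subn0 /eqAmod => H; have := rpredD H yp; rewrite subrK.
split=> // x y xO yO.
rewrite (principal_idealE p0 (quadratic_integerM xO yO)) !(principal_idealE p0) //.
move: xO yO => [[a [b xE]] xA] [[a' [b' yE]] yA] xy.
have {xE} xE : x = quad a b by []. 
have {yE} yE : y = quad a' b' by [].
rewrite {}xE {}yE in xA yA xy *.
have normE c d : quad c d \in Aint -> exists n : int, quad c d * quad c (- d) = n%:~R.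
  move=> cdA; have cdA' := conj_Aint hD cdA.
  have H : quad c d * quad c (- d) = ratr (c ^+ 2 - d ^+ 2 * D%:~R).
    rewrite quadM; have -> : c * - d + d * c = 0 by ring.
    by rewrite /quad rmorph0 mul0r addr0; congr ratr; ring.
  have [n nE] : exists n : int, c ^+ 2 - d ^+ 2 * D%:~R = n%:~R.
    by apply: rat_Aint_int; rewrite -H rpredM.
  by exists n; rewrite H nE ratr_int.
(* If p divides the norm n of y, it divides y^(p+1), hence y^(p^2) as p + 1 <= p^2. Conjugating
   twice shows that y^(p^2) is congruent to y. *)
have norm_dvd c d (n : int) : quad c d \in Aint -> quad c d * quad c (- d) = n%:~R ->
    (p%:Z %| n)%Z -> (p %| quad c d)%A.
  move=> cdA nE pn; have cdA' := conj_Aint hD cdA.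
  have fr := frob _ _ cdA; rewrite eN1 mulN1r in fr.
  have fr' := frob _ _ cdA'; rewrite eN1 mulN1r opprK in fr'.
  have cp1 : (p %| quad c d ^+ p.+1)%A.
    rewrite -eqAmod0 exprS; apply: eqAmod_trans (eqAmodM _ _ (eqAmod_refl _ _) fr) _ => //.
    by rewrite nE eqAmod0 dvdA_int.
  have cpp : (p %| (quad c d ^+ p) ^+ p)%A.
    rewrite -exprM -(@subnK p.+1 (p * p)); last by have := prime_gt1 p_pr; nia.
    by rewrite exprD; apply: dvdA_mulr => //; rewrite rpredX.
  have : (quad c d == (quad c d ^+ p) ^+ p %[mod p])%A.
    rewrite eqAmod_sym; apply: eqAmod_trans fr'.
    by apply: eqAmod_exp => //; rewrite rpredX.
  by rewrite /eqAmod => H; have := rpredD H cpp; rewrite subrK.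
have [m mE] := normE _ _ xA; have [n nE] := normE _ _ yA.
have : (p%:Z %| m * n)%Z.
  rewrite -dvdA_int // rmorphM /= -mE -nE mulrACA mulrC.
  by apply: dvdA_mulr => //; rewrite rpredM ?conj_Aint.
rewrite dvdzE abszM /= Euclid_dvdM // => /orP[pm|pn]; [left|right].
  exact: norm_dvd xA mE pm.
exact: norm_dvd yA nE pn.
Qed.
End InertCriterion.

(** * Character sums *)

Lemma horner_eqmod (f : {poly int}) (m x y : int) :
  (x = y %[mod m])%Z -> (f.[x] = f.[y] %[mod m])%Z.
Proof.
move=> xy; elim/poly_ind: f => [|f c IHf]; first by rewrite !horner0.
by rewrite !hornerE -modzDml -modzMm IHf xy modzMm modzDml.
Qed.

Definition periodic (T : Type) (m : nat) (F : nat -> T) := forall a, F (a %% m)%N = F a.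

Lemma periodic_dvd T m n (F : nat -> T) : (m %| n)%N -> periodic m F -> periodic n F.
Proof. by move=> mn Fm a; rewrite -Fm modn_dvdm. Qed.

Lemma sum_periodic k m (F : nat -> int) : periodic m F ->
  \sum_(a < k * m) F a = k%:Z * \sum_(a < m) F a.
Proof.
move=> Fm; elim: k => [|k IHk]; first by rewrite mul0n big_ord0 mul0r.
rewrite mulSn big_split_ord /= intS mulrDl mul1r -IHk; congr (_ + _).
by apply: eq_bigr => a _; rewrite -Fm modnDl Fm.
Qed.

Lemma sum_crt m n (F G : nat -> int) : coprime m n -> (0 < m)%N -> (0 < n)%N ->
  periodic m F -> periodic n G ->
  \sum_(a < m * n) F a * G a = (\sum_(a < m) F a) * (\sum_(a < n) G a).
Proof.
move=> mn m0 n0 Fm Gn.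
pose h (a : 'I_(m * n)) : 'I_m * 'I_n :=
  (Ordinal (ltn_pmod a m0), Ordinal (ltn_pmod a n0)).
have h_bij : bijective h.
  apply: inj_card_bij; last by rewrite card_prod !card_ord.
  move=> a b [abm abn]; apply/val_inj => /=.
  have /eqP : a == b %[mod m * n] by rewrite chinese_remainder // abm abn !eqxx.
  by rewrite !modn_small.
rewrite mulr_suml; under [RHS]eq_bigr do rewrite mulr_sumr.
rewrite pair_big /= (reindex h); last exact: onW_bij.
by apply: eq_bigr => a _ /=; rewrite Fm Gn.
Qed.

Lemma sum_prod_crt m (r : seq nat) (F : nat -> int) (G : nat -> nat -> int) :
  (0 < m)%N -> all prime r -> uniq r -> all (coprime m) r ->
  periodic m F -> (forall q, periodic q (G q)) ->
  \sum_(a < m * \prod_(q <- r) q) (F a * \prod_(q <- r) G q a)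
    = (\sum_(a < m) F a) * \prod_(q <- r) \sum_(a < q) G q a.
Proof.
move=> + + + + + Gq; elim: r m F => [|q r IHr] m F m0 /=.
  by move=> _ _ _ _; rewrite !big_nil muln1 mulr1; apply: eq_bigr => a _; rewrite big_nil mulr1.
move=> /andP[q_pr r_pr] /andP[qr r_uniq] /andP[mq mr] Fm.
rewrite !big_cons mulnA; under eq_bigr do rewrite big_cons mulrA.
have q0 := prime_gt0 q_pr.
(* The prime q is absorbed into the modulus, and its factor into F, before the induction hypothesis
   is applied. *)
rewrite (IHr (m * q)%N (fun a => F a * G q a)) ?muln_gt0 ?m0 //.
- by rewrite sum_crt // mulrA.
- apply/allP => p pr; rewrite coprimeMl (allP mr) // prime_coprime // dvdn_prime2 //.
    by apply: contraNneq qr => ->.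
  exact: (allP r_pr).
- move=> a; congr (_ * _).
    exact: (periodic_dvd (dvdn_mulr q (dvdnn m)) Fm).
  exact: (periodic_dvd (dvdn_mull m (dvdnn q)) (Gq q)).
Qed.

Section CharacterSums.
Variables (D : int) (hD : fundamental_discriminant D) (f : {poly int}).

Local Notation lod := (largest_odd_divisor D).
Local Notation tp := (two_part D).

Lemma chi4_mod a b : (a = b %[mod 4])%Z -> chi4 a = chi4 b.
Proof. by move=> ab; rewrite /chi4 ab. Qed.

Lemma chi8_mod a b : (a = b %[mod 8])%Z -> chi8 a = chi8 b.
Proof. by move=> ab; rewrite /chi8 ab. Qed.

Lemma kappa_mod d a b : d \in [:: 1; -4; 8; -8] -> (a = b %[mod `|d|%N%:Z])%Z ->
  kappa d a = kappa d b.
Proof.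
rewrite !inE => /or4P[] /eqP -> //= ab; rewrite /kappa /=.
- exact: chi4_mod.
- exact: chi8_mod.
- by rewrite (chi8_mod ab) (@chi4_mod a b) //; lia.
Qed.

Lemma periodic_horner T m (K : int -> T) :
  (forall a b, (a = b %[mod m%:Z])%Z -> K a = K b) -> periodic m (fun a => K f.[a%:Z]).
Proof.
by move=> Km a; apply/Km/horner_eqmod; rewrite -modz_nat modz_mod.
Qed.

Lemma two_part_gt0 : (0 < `|tp|)%N.
Proof. by have := two_part_mem D; rewrite !inE => /or4P[] /eqP ->. Qed.

Lemma coprime_two_part q : q \in primes lod -> coprime `|tp| q.
Proof.
have [_ [_ lod_odd]] := fundamental_discriminantE hD.
rewrite mem_primes => /and3P[q_pr _ /dvdn_odd /(_ lod_odd) q_odd].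
have c2 k : coprime (2 ^ k) q by rewrite coprimeXl // coprime2n.
have := two_part_mem D; rewrite !inE => /or4P[] /eqP ->;
  by [exact: (c2 0%N)|exact: (c2 2)|exact: (c2 3)].
Qed.

Lemma quad_char_sum :
  \sum_(a < `|D|%N) quad_char D f.[a%:Z] =
  (\sum_(a < `|tp|%N) kappa tp f.[a%:Z]) *
  \prod_(q <- primes lod) \sum_(a < q) legendre f.[a%:Z] q.
Proof.
have [_ [Dabs _]] := fundamental_discriminantE hD.
rewrite -(prod_primes_lod hD) in Dabs.
rewrite -(big_mkord xpredT (fun a : nat => quad_char D f.[a%:Z])) Dabs big_mkord.
apply: (sum_prod_crt (F := fun a => kappa tp f.[a%:Z])
          (G := fun q a => legendre f.[a%:Z] q)).
- exact: two_part_gt0.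
- exact: all_prime_primes.
- exact: primes_uniq.
- by apply/allP => q; exact: coprime_two_part.
- apply: periodic_horner => a b; exact: kappa_mod (two_part_mem D).
- by move=> q; apply: (@periodic_horner _ _ (fun n => legendre n q)) => a b; exact: legendre_mod.
Qed.

Lemma quad_char_sqr_sum :
  \sum_(a < `|D|%N) quad_char D f.[a%:Z] ^+ 2 =
  (\sum_(a < `|tp|%N) kappa tp f.[a%:Z] ^+ 2) *
  \prod_(q <- primes lod) \sum_(a < q) legendre f.[a%:Z] q ^+ 2.
Proof.
have [_ [Dabs _]] := fundamental_discriminantE hD.
rewrite -(prod_primes_lod hD) in Dabs.
under [LHS]eq_bigr do rewrite /quad_char exprMn -prodrXl.
rewrite -(big_mkord xpredT (fun a : nat => kappa tp f.[a%:Z] ^+ 2 *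
  \prod_(q <- primes lod) legendre f.[a%:Z] q ^+ 2)) Dabs big_mkord.
apply: (sum_prod_crt (F := fun a => kappa tp f.[a%:Z] ^+ 2)
          (G := fun q a => legendre f.[a%:Z] q ^+ 2)).
- exact: two_part_gt0.
- exact: all_prime_primes.
- exact: primes_uniq.
- by apply/allP => q; exact: coprime_two_part.
- apply: (@periodic_horner _ _ (fun n => kappa tp n ^+ 2)) => a b ab.
  by rewrite (kappa_mod (two_part_mem D) ab).
- move=> q; apply: (@periodic_horner _ _ (fun n => legendre n q ^+ 2)) => a b ab.
  by rewrite (legendre_mod ab).
Qed.

Definition nb_inert_residues : nat := #|[pred a : 'I_`|D|%N | quad_char D f.[a%:Z] == -1]|.

Lemma card_ord_sum (n : nat) (P : pred 'I_n) : #|P|%:Z = \sum_(i < n) (P i : nat)%:Z.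
Proof.
rewrite -sum1_card -(big_morph Posz PoszD (erefl : Posz 0 = 0)) big_mkcond /=.
by congr Posz; apply: eq_bigr => i _; case: ifP.
Qed.

Lemma nb_admissibleE : (nb_admissible D f)%:Z = \sum_(a < `|D|%N) quad_char D f.[a%:Z] ^+ 2.
Proof. by rewrite card_ord_sum; apply: eq_bigr => a _; rewrite quad_char_sqr. Qed.

(** Termwise: twice the indicator of chi = -1 is chi^2 - chi for chi in {-1, 0, 1}. *)
Lemma nb_inert_residuesE :
  2 * nb_inert_residues%:Z = (nb_admissible D f)%:Z - \sum_(a < `|D|%N) quad_char D f.[a%:Z].
Proof.
rewrite nb_admissibleE card_ord_sum mulr_sumr -sumrB; apply: eq_bigr => a _ /=.
have /orP : coprimez f.[a%:Z] D || ~~ coprimez f.[a%:Z] D by exact: orbN.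
case=> [/(quad_char_sign hD)[->|->] //|ncop].
have := quad_char_sqr f.[a%:Z] hD; rewrite (negPf ncop) => /eqP.
by rewrite sqrf_eq0 => /eqP ->.
Qed.

(** The squared symbol is 1 exactly off the roots of f; this is the origin of the denominator of
    [a_prime]. *)
Lemma nb_rootsE q : prime q ->
  \sum_(j < q) legendre f.[j%:Z] q ^+ 2 = q%:Z - (nb_roots q f)%:Z.
Proof.
move=> q_pr; rewrite card_ord_sum.
apply: (canRL (addrK _)); rewrite -big_split /=.
transitivity (\sum_(j < q) 1 : int); last by rewrite sumr_const card_ord -mulr_natr mul1r natz.
apply: eq_bigr => j _; rewrite legendre_sqr //= eqz_mod_dvd subr0.
by case: (_ \in _).
Qed.

End CharacterSums.

(** * The density of inert residues in terms of [alpha] and [a_coef] *)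

Section Formula.
Variables (R : realType) (D : int) (hD : fundamental_discriminant D) (f : {poly int}).

Local Notation lod := (largest_odd_divisor D).
Local Notation tp := (two_part D).
Local Notation N := (nb_residues 8 ^~ f).
Local Notation al := (alpha R f).

(** The modulus is raised from 4 to 8 to match [alpha], which counts residues modulo 8 in all
    cases. *)
Lemma chi4_residues n : chi4 n =
  ((n == 1 %[mod 8])%Z : nat)%:Z + ((n == 5 %[mod 8])%Z : nat)%:Z
  - ((n == 3 %[mod 8])%Z : nat)%:Z - ((n == 7 %[mod 8])%Z : nat)%:Z.
Proof. by rewrite /chi4; do ?case: eqP => //=; lia. Qed.

Lemma chi8_residues n : chi8 n =
  ((n == 1 %[mod 8])%Z : nat)%:Z + ((n == 7 %[mod 8])%Z : nat)%:Z
  - ((n == 3 %[mod 8])%Z : nat)%:Z - ((n == 5 %[mod 8])%Z : nat)%:Z.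
Proof. by rewrite /chi8; do ?case: eqP => //=; lia. Qed.

Lemma chi4M8_residues n : chi4 n * chi8 n =
  ((n == 1 %[mod 8])%Z : nat)%:Z + ((n == 3 %[mod 8])%Z : nat)%:Z
  - ((n == 5 %[mod 8])%Z : nat)%:Z - ((n == 7 %[mod 8])%Z : nat)%:Z.
Proof. by rewrite /chi4 /chi8; do ?case: eqP => //=; lia. Qed.

Lemma sum_residues (a b c d : nat) (K : int -> int) :
  (forall n, K n = ((n == a %[mod 8])%Z : nat)%:Z + ((n == b %[mod 8])%Z : nat)%:Z
    - ((n == c %[mod 8])%Z : nat)%:Z - ((n == d %[mod 8])%Z : nat)%:Z) ->
  \sum_(s < 8) K f.[s%:Z] = (N a)%:Z + (N b)%:Z - (N c)%:Z - (N d)%:Z.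
Proof.
move=> KE; rewrite !card_ord_sum -big_split -!sumrB /=.
by apply: eq_bigr => s _; rewrite KE.
Qed.

(** Eight consecutive integers are 4 periods modulo 2. This identifies the denominator of [alpha] as
    the number of s modulo 8 with f(s) odd. *)
Lemma sum_odd : \sum_(s < 8) (odd `|f.[s%:Z]|%N : nat)%:Z = 4 * (nb_residues 2 1 f)%:Z.
Proof.
rewrite card_ord_sum.
rewrite (@sum_periodic 4 2 (fun s : nat => (odd `|f.[s%:Z]|%N : nat)%:Z)).
  by congr (_ * _); apply: eq_bigr => s _ /=; congr (Posz (nat_of_bool _)); lia.
by apply: (@periodic_horner f _ 2 (fun n => (odd `|n|%N : nat)%:Z)) => a b ab; congr (Posz (nat_of_bool _)); lia.
Qed.

(** Passing from m to 8 terms multiplies numerator and denominator by the same k. *)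
Lemma two_part_ratio_sum8 m k (K : int -> int) (x : int) : (0 < k)%N -> (k * m = 8)%N ->
  (forall a b, (a = b %[mod m%:Z])%Z -> K a = K b) ->
  (forall n, K n ^+ 2 = (odd `|n|%N : nat)%:Z) ->
  \sum_(s < 8) K f.[s%:Z] = x ->
  (\sum_(s < m) K f.[s%:Z])%:~R / (\sum_(s < m) K f.[s%:Z] ^+ 2)%:~R
  = x%:~R / (4 * (nb_residues 2 1 f)%:R) :> R.
Proof.
move=> k0 km Kmod K2 <-.
have -> : (4 * (nb_residues 2 1 f)%:R : R) = (4 * (nb_residues 2 1 f)%:Z)%:~R.
  by rewrite rmorphM.
rewrite -sum_odd; under [X in _ = _ / X%:~R]eq_bigr do rewrite -K2.
rewrite -km (@sum_periodic k m (fun s => K f.[s%:Z])); last exact: periodic_horner.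
rewrite (@sum_periodic k m (fun s => K f.[s%:Z] ^+ 2)); last first.
  by apply: (@periodic_horner f _ m (fun n => K n ^+ 2)) => a b /Kmod ->.
rewrite !rmorphM /= -mulf_div divff ?mul1r //.
by rewrite pnatr_eq0 -lt0n.
Qed.

(** The local factor at 2, analogous to [a_prime] at the odd primes. *)
Definition two_part_ratio : R :=
  (\sum_(s < `|tp|%N) kappa tp f.[s%:Z])%:~R / (\sum_(s < `|tp|%N) kappa tp f.[s%:Z] ^+ 2)%:~R.

Lemma two_part_ratio1 : tp = 1 -> two_part_ratio = 1.
Proof.
by rewrite /two_part_ratio => ->; rewrite !big_ord_recl !big_ord0 /kappa /= divff.
Qed.

Lemma kappa_sqr_odd d n : d \in [:: -4; 8; -8] ->
  kappa d n ^+ 2 = (odd `|n|%N : nat)%:Z.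
Proof.
move=> dI; rewrite kappa_sqr ?inE; last by rewrite !inE in dI; rewrite dI orbT.
have c2 k : coprime `|n|%N (2 ^ k.+1) = odd `|n|%N by rewrite coprime_pexpr // coprimen2.
move: dI; rewrite coprimezE !inE => /or3P[] /eqP ->; congr (Posz (nat_of_bool _)).
- exact: (c2 1%N).
- exact: (c2 2%N).
- exact: (c2 2%N).
Qed.

Lemma two_part_ratioN4 : tp = -4 -> two_part_ratio = al 1 + al 5 - al 3 - al 7.
Proof.
rewrite /two_part_ratio => ->.
rewrite (@two_part_ratio_sum8 4 2 (kappa (-4)) _ _ _ _ _ (@sum_residues 1 5 3 7 _ chi4_residues)) //.
- by rewrite !rmorphB rmorphD /= /alpha !mulrBl mulrDl.
- by move=> a b ab; apply: (@kappa_mod (-4)).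
- by move=> n; exact: kappa_sqr_odd.
Qed.

Lemma two_part_ratio8 : tp = 8 -> two_part_ratio = al 1 + al 7 - al 3 - al 5.
Proof.
rewrite /two_part_ratio => ->.
rewrite (@two_part_ratio_sum8 8 1 (kappa 8) _ _ _ _ _ (@sum_residues 1 7 3 5 _ chi8_residues)) //.
- by rewrite !rmorphB rmorphD /= /alpha !mulrBl mulrDl.
- by move=> a b ab; apply: (@kappa_mod 8).
- by move=> n; exact: kappa_sqr_odd.
Qed.

Lemma two_part_ratioN8 : tp = -8 -> two_part_ratio = al 1 + al 3 - al 5 - al 7.
Proof.
rewrite /two_part_ratio => ->.
rewrite (@two_part_ratio_sum8 8 1 (kappa (-8)) _ _ _ _ _ (@sum_residues 1 3 5 7 _ chi4M8_residues)) //.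
- by rewrite !rmorphB rmorphD /= /alpha !mulrBl mulrDl.
- by move=> a b ab; apply: (@kappa_mod (-8)).
- by move=> n; exact: kappa_sqr_odd.
Qed.

Lemma quad_char_ratio :
  (\sum_(a < `|D|%N) quad_char D f.[a%:Z])%:~R / (nb_admissible D f)%:R
  = two_part_ratio * a_coef R f lod.
Proof.
have -> : (nb_admissible D f)%:R = (\sum_(a < `|D|%N) quad_char D f.[a%:Z] ^+ 2)%:~R :> R.
  by rewrite -nb_admissibleE.
rewrite quad_char_sum // quad_char_sqr_sum // !rmorphM /= -mulf_div; congr (_ * _).
rewrite !rmorph_prod -prodf_div; apply: eq_big_seq => q.
rewrite mem_primes => /andP[q_pr _].
by rewrite nb_rootsE // rmorphB.
Qed.

Lemma inert_density : nb_admissible D f <> 0%N ->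
  2 * ((nb_inert_residues D f)%:R / (nb_admissible D f)%:R)
  = 1 - two_part_ratio * a_coef R f lod.
Proof.
move=> A0; rewrite -quad_char_ratio.
have A0' : (nb_admissible D f)%:R != 0 :> R by rewrite pnatr_eq0; apply/eqP.
have := nb_inert_residuesE hD f => /(congr1 (intr : int -> R)).
rewrite rmorphM rmorphB /= => BE; rewrite mulrA.
have -> : 2 * (nb_inert_residues D f)%:R = (nb_admissible D f)%:R -
   (\sum_(a < `|D|%N) quad_char D f.[a%:Z])%:~R :> R by exact: BE.
by rewrite mulrBl divff.
Qed.

(** The number of admissible residues is a product of local factors: q - N_q at each odd q, and at
    2, for even D, a divisor of the denominator of [alpha]. *)
Lemma coefficients_defined_admissible :
  coefficients_defined D f -> nb_admissible D f <> 0%N.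
Proof.
move=> [roots_q res2]; have := nb_admissibleE hD f.
rewrite quad_char_sqr_sum // => AE A0; move/eqP: AE; rewrite A0 eq_sym mulf_eq0.
apply/negP; rewrite negb_or; apply/andP; split; last first.
  rewrite prodf_seq_neq0; apply/allP => q qD; rewrite nb_rootsE.
    by apply/eqP => H; apply: (roots_q q qD); lia.
  by move: qD; rewrite mem_primes => /andP[].
have := two_part_mem D; rewrite inE => /orP[/eqP ->|tI].
  by rewrite big_ord_recl big_ord0 /kappa.
have D2 : (2 %| D)%Z.
  by apply: contraT => D2; move: tI; rewrite /two_part D2.
have m8 : exists k, (k * `|tp| = 8)%N.
  by move: tI; rewrite !inE => /or3P[] /eqP ->; [exists 2%N|exists 1%N|exists 1%N].
have [k km] := m8.
apply: contra_notN (res2 D2) => /eqP S0.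
have := sum_odd; have -> : \sum_(s < 8) (odd `|f.[s%:Z]|%N : nat)%:Z
    = \sum_(s < 8) kappa tp f.[s%:Z] ^+ 2.
  by apply: eq_bigr => s _; rewrite kappa_sqr_odd.
rewrite -km (@sum_periodic k _ (fun s => kappa tp f.[s%:Z] ^+ 2)) ?S0; first by lia.
by apply: (@periodic_horner f _ _ (fun n => kappa tp n ^+ 2)) => a b /(kappa_mod (two_part_mem D)) ->.
Qed.

End Formula.

(** * Counting arguments and values *)

Lemma poly_eventually_pos (f : {poly int}) : 0 < lead_coef f ->
  exists N, forall n : nat, (N <= n)%N -> 0 < f.[n%:Z].
Proof.
elim/poly_ind: f => [|f c IHf]; first by rewrite lead_coef0.
have [->|f0] := eqVneq f 0.
  by rewrite mul0r add0r lead_coefC => c0; exists 0%N => n _; rewrite hornerC.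
rewrite lead_coefDl; last first.
  by rewrite size_polyC size_mulX // (leq_ltn_trans (leq_b1 _)) // ltnS size_poly_gt0.
rewrite lead_coefMX => /IHf[N fN]; exists (maxn N `|c|%N.+1) => n.
rewrite geq_max !hornerE => /andP[/fN fn cn]; move: fn; move: f.[_] => F F0.
(* A positive integer F is at least 1, so F n >= n > |c|. *)
have : 0 <= (F - 1) * n%:Z by apply: mulr_ge0; lia.
by rewrite mulrBl mul1r; move: (F * _) => G; lia.
Qed.

Lemma poly_eventually_increasing (f : {poly int}) : 0 < lead_coef f -> (1 < size f)%N ->
  exists N, forall n : nat, (N <= n)%N -> f.[n%:Z] < f.[n.+1%:Z].
Proof.
elim/poly_ind: f => [|f c IHf]; first by rewrite lead_coef0.
have [->|f0] := eqVneq f 0.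
  by rewrite mul0r add0r size_polyC; case: eqP.
have cX : (size (c%:P : {poly int}) < size (f * 'X)%R)%N.
  by rewrite size_polyC size_mulX // (leq_ltn_trans (leq_b1 _)) // ltnS size_poly_gt0.
rewrite lead_coefDl // size_polyDl // lead_coefMX => lf _.
have [N fN] := poly_eventually_pos lf.
have [f1|f1] := leqP (size f) 1.
  have [k fE] : exists k, f = k%:P by exists f`_0; exact: size1_polyC.
  exists N => n /fN; rewrite fE !hornerE intS; lia.
have [M fM] := IHf lf f1; exists (maxn N M) => n; rewrite geq_max => /andP[nN nM].
have := fM n nM; have := fN n.+1 (leqW nN); rewrite !hornerE.
move: f.[n%:Z] f.[n.+1%:Z] => F G G0 FG.
(* The increment is G (n + 1) - F n = (G - F) n + G, with G > 0. *)
have : 0 <= (G - F) * n%:Z by apply: mulr_ge0; lia.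
by rewrite mulrBl intS mulrDr mulr1; move: (G * _) (F * _) => u v; lia.
Qed.

Lemma card_count (n : nat) (P : pred nat) : #|[pred p : 'I_n | P p]| = count P (iota 0 n).
Proof. by rewrite cardE size_filter -[iota 0 n]val_enum_ord count_map enumT. Qed.

Section Counting.
Variables (f : {poly int}) (N : nat).
Hypothesis f_incr : forall n : nat, (N <= n)%N -> f.[n%:Z] < f.[n.+1%:Z].

(** The predicate [Q] will be [predT] or inertness, so that one comparison with [nb_values] serves
    both terms of the ratio. *)
Definition nb_args (Q : pred nat) (X : nat) : nat :=
  count (fun n : nat => primez f.[n%:Z] && Q `|f.[n%:Z]|%N) (iota 0 X.+1).

Definition nb_values (Q : pred nat) (x : nat) : nat :=
  count (fun p => [&& prime p, `[< represented f p >] & Q p]) (iota 0 x.+1).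

Lemma horner_mono (m n : nat) : (N <= m)%N -> (m <= n)%N -> f.[m%:Z] <= f.[n%:Z].
Proof.
move=> Nm; elim: n => [|n IHn]; first by rewrite leqn0 => /eqP ->.
rewrite leq_eqVlt => /predU1P[-> //|mn]; apply: le_trans (IHn mn) _.
by apply/ltW/f_incr/(leq_trans Nm).
Qed.

Lemma horner_strict_mono (m n : nat) : (N <= m)%N -> (m < n)%N -> f.[m%:Z] < f.[n%:Z].
Proof. by move=> Nm mn; apply: lt_le_trans (f_incr Nm) (horner_mono (leqW Nm) mn). Qed.

Lemma primezE (z : int) : primez z -> z = `|z|%N%:Z /\ prime `|z|%N.
Proof. by case: z. Qed.

(** Beyond X all values exceed x, so each value counted has an argument up to X; one argument per
    value is enough, hence no error term. *)
Lemma nb_values_le Q X x : (N <= X)%N -> x%:Z < f.[X.+1%:Z] ->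
  (nb_values Q x <= nb_args Q X)%N.
Proof.
move=> NX xX; rewrite /nb_values /nb_args -!size_filter.
rewrite -[leqRHS](size_map (fun n : nat => `|f.[n%:Z]|%N)).
apply: uniq_leq_size => [|p]; first by rewrite filter_uniq ?iota_uniq.
rewrite mem_filter mem_iota => /andP[/and3P[p_pr /asboolP[n fn] Qp] /andP[_ px]].
apply/mapP; exists n; last by rewrite fn.
rewrite mem_filter mem_iota fn /= p_pr Qp /= add0n ltnS leqNgt; apply/negP => Xn.
have := horner_mono (leqW NX) Xn; rewrite fn; lia.
Qed.

(** From N on f is injective; the N smaller arguments, where values may repeat or be large, make up
    the error. *)
Lemma nb_args_le Q X x : f.[X%:Z] <= x%:Z ->
  (nb_args Q X <= nb_values Q x + N)%N.
Proof.
move=> Xx; have [XN|NX] := leqP X.+1 N.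
  apply: leq_trans (count_size _ _) _; rewrite size_iota; lia.
rewrite /nb_args -[X.+1](subnKC (ltnW NX)) iotaD count_cat addnC leq_add //; last first.
  by apply: leq_trans (count_size _ _) _; rewrite size_iota.
rewrite /nb_values -!size_filter add0n.
rewrite -[leqLHS](size_map (fun n : nat => `|f.[n%:Z]|%N)).
apply: uniq_leq_size => [|p].
  rewrite map_inj_in_uniq ?filter_uniq ?iota_uniq // => m n.
  rewrite !mem_filter !mem_iota => /andP[/andP[/primezE[fm _] _] /andP[Nm _]].
  move=> /andP[/andP[/primezE[fn _] _] /andP[Nn _]] fmn.
  have {fm fn fmn} fmn : f.[m%:Z] = f.[n%:Z] by rewrite fm fn fmn.
  case: (ltngtP m n) => // [/(horner_strict_mono Nm)|/(horner_strict_mono Nn)]; rewrite fmn; lia.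
move=> /mapP[n]; rewrite mem_filter mem_iota => /andP[/andP[/primezE[fn fn_pr] Qn] /andP[Nn nX]] ->.
rewrite mem_filter mem_iota fn_pr Qn /= add0n ltnS andbT; apply/andP; split.
  by apply/asboolP; exists n.
have nX' : (n <= X)%N by lia.
have := horner_mono Nn nX'; lia.
Qed.

End Counting.

Lemma count_agree (N : nat) (P Q : pred nat) m :
  (forall n, (N <= n)%N -> P n -> Q n) ->
  (count P (iota 0 m) <= count Q (iota 0 m) + N)%N.
Proof.
move=> PQ; have [mN|Nm] := leqP m N.
  by apply: leq_trans (count_size _ _) _; rewrite size_iota; lia.
rewrite -[m](subnKC (ltnW Nm)) iotaD !count_cat add0n.
have H1 : (count P (iota 0 N) <= N)%N by apply: leq_trans (count_size _ _) _; rewrite size_iota.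
have H2 : (count P (iota N (m - N)) <= count Q (iota N (m - N)))%N.
  rewrite -!size_filter; apply: uniq_leq_size; first by rewrite filter_uniq ?iota_uniq.
  move=> n; rewrite !mem_filter => /andP[Pn nI]; rewrite nI andbT.
  by apply: PQ Pn; move: nI; rewrite mem_iota => /andP[].
lia.
Qed.

Section InertArguments.
Variables (D : int) (hD : fundamental_discriminant D) (f : {poly int}).

(** Arranged by residue class, so that equidistribution applies to each term. *)
Definition nb_inert_args (X : nat) : nat :=
  (\sum_(a < `|D|%N | (quad_char D f.[(a : nat)%:Z] == -1)%R)
     nb_prime_args_in `|D|%N a f X)%N.

Lemma disc_gt0 : (0 < `|D|)%N.
Proof.
have [_ [-> lod_odd]] := fundamental_discriminantE hD.
by rewrite muln_gt0 two_part_gt0; case: largest_odd_divisor lod_odd.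
Qed.

Lemma quad_char_mod (m n : int) : (m = n %[mod D])%Z -> quad_char D m = quad_char D n.
Proof.
move=> mn; have [_ [DE _]] := fundamental_discriminantE hD.
have mnd d : (d %| `|D|)%N -> (m = n %[mod d%:Z])%Z.
  move=> dD; apply/eqP; rewrite eqz_mod_dvd; rewrite dvdzE.
  by apply: dvdn_trans dD _; move/eqP: mn; rewrite eqz_mod_dvd dvdzE.
rewrite /quad_char; congr (_ * _).
  by apply: kappa_mod (two_part_mem D) _; apply: mnd; rewrite DE dvdn_mulr.
apply: eq_big_seq => q; rewrite mem_primes => /and3P[_ _ qD].
by apply: legendre_mod; apply: mnd; rewrite DE dvdn_mull.
Qed.

Lemma nb_inert_argsE X : nb_inert_args X =
  count (fun n => primez f.[n%:Z] && (quad_char D f.[n%:Z] == -1)) (iota 0 X.+1).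
Proof.
have cE (P : pred nat) : count P (iota 0 X.+1) = (\sum_(n < X.+1) P n)%N.
  by rewrite -card_count -sum1_card big_mkcond; apply: eq_bigr => n _; rewrite inE; case: (P n).
rewrite cE /nb_inert_args.
under eq_bigr => a _ do rewrite /nb_prime_args_in
  (card_count X.+1 (fun n => (n == a %[mod `|D|])%N && primez f.[n%:Z])) cE.
rewrite exchange_big; apply: eq_bigr => n _ /=.
pose b : 'I_`|D| := Ordinal (ltn_pmod n disc_gt0).
have bE : quad_char D f.[n%:Z] = quad_char D f.[(b : nat)%:Z].
  apply: quad_char_mod; apply: horner_eqmod.
  by rewrite -(modz_abs n) -(modz_abs b) !modz_nat /= modn_mod.
have ab (a : 'I_`|D|) : (n == a %[mod `|D|])%N = (a == b).
  by rewrite [(a %% _)%N]modn_small // eq_sym.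
rewrite bE; under eq_bigr do rewrite ab.
rewrite big_mkcond (bigD1 b) //= big1 => [|a /negPf ->]; last by case: ifP.
by rewrite eqxx /= addn0; case: ifP; rewrite ?andbT ?andbF.
Qed.

(** A prime larger than |D| does not divide D, so inertness is read from the character; only
    arguments below N can disagree. *)
Lemma nb_inert_args_bounds N X :
  (forall n : nat, (N <= n)%N -> `|D| < f.[n%:Z]) ->
  (nb_args f (fun p => `[< inert D p >]) X <= nb_inert_args X + N)%N /\
  (nb_inert_args X <= nb_args f (fun p => `[< inert D p >]) X + N)%N.
Proof.
move=> fD; have inertE n : (N <= n)%N -> primez f.[n%:Z] ->
    `[< inert D `|f.[n%:Z]|%N >] = (quad_char D f.[n%:Z] == -1).
  move=> Nn /primezE[fn fn_pr]; have fnD := fD n Nn.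
  rewrite [in RHS]fn; apply/asboolP/eqP; apply inert_quad_char => //;
  rewrite coprimezE prime_coprime //; apply/negP => /(dvdn_leq disc_gt0); lia.
rewrite nb_inert_argsE; split; apply: count_agree => n Nn /andP[fn].
  by rewrite inertE // fn.
by rewrite -inertE // fn.
Qed.
End InertArguments.

(** * Limits *)

Lemma cvg_bounded_diff (R : realType) (c : nat) (u v w : nat -> nat) (l : R) :
  (\forall x \near \oo, (u x <= v x + c)%N /\ (v x <= u x + c)%N)%classic ->
  ((fun x => (w x)%:R : R) @ \oo --> +oo)%classic ->
  ((fun x => (v x)%:R / (w x)%:R) @ \oo --> l)%classic ->
  ((fun x => (u x)%:R / (w x)%:R) @ \oo --> l)%classic.
Proof.
move=> uv w_oo vl.
have w0 : ((fun x => ((w x)%:R : R)^-1) @ \oo --> 0)%classic.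
  apply/gtr0_cvgV0 => //.
  have /cvgryPge /(_ 1) := w_oo; apply: filterS => x; exact: lt_le_trans.
have cw0 : ((fun x => c%:R * ((w x)%:R : R)^-1) @ \oo --> 0)%classic.
  by rewrite -[0](mulr0 c%:R); apply: cvgM w0; exact: cvg_cst.
apply: (@squeeze_cvgr _ _ _ _ (fun x => (v x)%:R / (w x)%:R - c%:R / (w x)%:R)
  (fun x => (v x)%:R / (w x)%:R + c%:R / (w x)%:R)).
- apply: filterS uv => x [uv vu].
  rewrite -mulrBl -mulrDl; apply/andP; split; apply: ler_wpM2r; rewrite ?invr_ge0 ?ler0n //.
    by rewrite lerBlDr -natrD ler_nat.
  by rewrite -natrD ler_nat.
- by rewrite -[l]subr0; exact: cvgB.
- by rewrite -[l]addr0; exact: cvgD.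
Qed.

Lemma cvg_ratio_bounded_diff (R : realType) (c : nat) (r t e w : nat -> nat) (l : R) :
  (\forall x \near \oo, (r x <= e x + c)%N /\ (e x <= r x + c)%N)%classic ->
  (\forall x \near \oo, (t x <= w x + c)%N /\ (w x <= t x + c)%N)%classic ->
  ((fun x => (w x)%:R : R) @ \oo --> +oo)%classic ->
  ((fun x => (e x)%:R / (w x)%:R) @ \oo --> l)%classic ->
  ((fun x => (r x)%:R / (t x)%:R) @ \oo --> l)%classic.
Proof.
move=> re tw w_oo el.
have w_gt0 : (\forall x \near \oo, 0 < (w x)%:R :> R)%classic.
  have /cvgryPge /(_ 1) := w_oo; apply: filterS => x; exact: lt_le_trans.
have rl := cvg_bounded_diff re w_oo el.
have t1 : ((fun x => (t x)%:R / (w x)%:R : R) @ \oo --> (1 : R))%classic.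
  apply: (cvg_bounded_diff tw w_oo); apply: cvg_near_cst.
  by apply: filterS w_gt0 => x w0; rewrite divff // gt_eqF.
have : ((fun x => (r x)%:R / (w x)%:R * ((t x)%:R / (w x)%:R)^-1) @ \oo --> l * (1 : R)^-1)%classic.
  exact: cvgM rl (cvgV (oner_neq0 R) t1).
rewrite invr1 mulr1; apply: cvg_trans; apply: near_eq_cvg.
apply: filterS w_gt0 => x w0 /=.
have w0' : (w x)%:R != 0 :> R by rewrite gt_eqF.
by rewrite invf_div mulrA divfK.
Qed.

Lemma infinite_set_unbounded (S : set nat) : infinite_set S ->
  forall K, exists2 n, (K <= n)%N & S n.
Proof.
move=> Sinf K; apply: contrapT => noS; apply: Sinf.
apply: (@sub_finite_set _ _ `I_K); last exact: finite_II.
move=> n Sn /=; rewrite ltnNge; apply/negP => Kn; apply: noS; by exists n.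
Qed.

Lemma nb_prime_argsE f X : nb_prime_args f X = nb_args f predT X.
Proof.
rewrite /nb_prime_args (card_count X.+1 (fun n => primez f.[n%:Z])).
by apply: eq_count => n; rewrite andbT.
Qed.

Lemma nb_prime_args_unbounded f : infinite_set [set n : nat | primez f.[n%:Z]]%classic ->
  forall K, exists X0, forall X, (X0 <= X)%N -> (K <= nb_prime_args f X)%N.
Proof.
move=> finf; elim=> [|K [X0 IHK]]; first by exists 0%N.
have [n nX fn] := infinite_set_unbounded finf X0.+1.
exists n => X nX'; apply: leq_ltn_trans (IHK X0 (leqnn _)) _.
rewrite /nb_prime_args !(card_count _ (fun n => primez f.[n%:Z])).
have -> : X.+1 = (X0.+1 + (X - X0))%N by lia.
rewrite iotaD count_cat -[ltnLHS]addn0 ltn_add2l -has_count.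
by apply/hasP; exists n => //; rewrite mem_iota; lia.
Qed.

Lemma nb_prime_args_cvg (R : realType) f :
  infinite_set [set n : nat | primez f.[n%:Z]]%classic ->
  ((fun X => (nb_prime_args f X)%:R : R) @ \oo --> +oo)%classic.
Proof.
move=> finf; apply/cvgryPge => A.
have [X0 HX] := nb_prime_args_unbounded finf (Num.trunc A).+1.
exists X0 => // X /= /HX AX; apply: le_trans (_ : (Num.trunc A).+1%:R <= _); last by rewrite ler_nat.
exact/ltW/truncnS_gt.
Qed.

Lemma nb_inert_args_cvg (R : realType) D f : fundamental_discriminant D ->
  equidistributed R D f -> nb_admissible D f <> 0%N ->
  ((fun X => (nb_inert_args D f X)%:R / (nb_prime_args f X)%:R) @ \oo -->
    ((nb_inert_residues D f)%:R / (nb_admissible D f)%:R : R))%classic.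
Proof.
move=> hD hequi /eqP A0.
have A0' : (nb_admissible D f)%:R != 0 :> R by rewrite pnatr_eq0.
have -> : (nb_inert_residues D f)%:R / (nb_admissible D f)%:R =
    \sum_(a < `|D|%N | quad_char D f.[(a : nat)%:Z] == -1) ((nb_admissible D f)%:R^-1 : R).
  by rewrite sumr_const mulr_natl.
have -> : (fun X => (nb_inert_args D f X)%:R / (nb_prime_args f X)%:R : R) =
    (fun X => \sum_(a < `|D|%N | quad_char D f.[(a : nat)%:Z] == -1)
       ((nb_prime_args_in `|D|%N a f X)%:R / (nb_prime_args f X)%:R)).
  by apply/funext => X; rewrite -mulr_suml natr_sum.
apply: cvg_big => [|a a_inert]; first exact: add_continuous.
(* The character is nonzero at f(a), so equidistribution applies to this class, which contributes
   the inverse of the number of admissible classes. *)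
have adm : admissible D f a.
  have := quad_char_sqr f.[(a : nat)%:Z] hD; rewrite (eqP a_inert) /admissible.
  by case: coprimez.
have : ((fun X => (nb_prime_args_in `|D|%N a f X)%:R /
    ((nb_prime_args f X)%:R / (nb_admissible D f)%:R) * (nb_admissible D f)%:R^-1) @ \oo
    --> (1 : R) * (nb_admissible D f)%:R^-1)%classic.
  by apply: cvgM (hequi a adm) _; exact: cvg_cst.
rewrite mul1r; apply: cvg_trans; apply: near_eq_cvg; apply: nearW => X /=.
by rewrite invf_div mulrA mulrAC mulfK.
Qed.

(** * The limit of the proportion of inert primes *)

Section Limit.
Variables (R : realType) (f : {poly int}) (D : int).
Hypotheses (hD : fundamental_discriminant D)
  (hinf : infinite_set [set n : nat | primez f.[n%:Z]]%classic)
  (hequi : equidistributed R D f).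

Lemma inert_ratioE x : inert_ratio R D f x =
  (nb_values f (fun p => `[< inert D p >]) x)%:R / (nb_values f predT x)%:R.
Proof.
rewrite /inert_ratio /nb_inert_primes /nb_primes /nb_values.
rewrite (card_count x.+1 (fun p => [&& prime p, `[< represented f p >] & `[< inert D p >]])).
rewrite (card_count x.+1 (fun p => prime p && `[< represented f p >])).
by congr (_ / _%:R); apply: eq_count => p; rewrite andbT.
Qed.

Lemma prime_values_lead_coef_gt0 : 0 < lead_coef f.
Proof.
rewrite ltNge; apply/negP; rewrite le_eqVlt lead_coef_eq0 => /orP[/eqP f0|lf].
  by have [n _ /=] := infinite_set_unbounded hinf 0; rewrite f0 horner0.
have [|N fN] := @poly_eventually_pos (- f); first by rewrite lead_coefN oppr_gt0.
have [n Nn /= /primezE[fn _]] := infinite_set_unbounded hinf N.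
by have := fN n Nn; rewrite hornerN oppr_gt0 fn.
Qed.

Lemma nonconstant_eventually : (1 < size f)%N -> exists N : nat,
  (forall n : nat, (N <= n)%N -> f.[n%:Z] < f.[n.+1%:Z]) /\
  (forall n : nat, (N <= n)%N -> `|D| < f.[n%:Z]).
Proof.
move=> f1; have [M fM] := poly_eventually_increasing prime_values_lead_coef_gt0 f1.
have fk k : f.[M%:Z] + k%:Z <= f.[(M + k)%N%:Z].
  elim: k => [|k IHk]; first by rewrite addn0 addr0.
  by have := fM (M + k)%N (leq_addr _ _); rewrite addnS; lia.
(* From M on the values rise by at least 1 per step, so |f(M)| + |D| + 1 steps carry f beyond
   |D|. *)
exists (M + (absz f.[M%:Z] + `|D|).+1)%N; split=> n Mn; first by apply: fM; lia.
have := fk (n - M)%N; rewrite subnKC; last by lia.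
by move: f.[n%:Z] f.[M%:Z] Mn => u v; lia.
Qed.

(** Some prime value f(n) exceeds |D|, hence is prime to D, and n modulo |D| is admissible. *)
Lemma nonconstant_admissible : (1 < size f)%N -> nb_admissible D f <> 0%N.
Proof.
move=> /nonconstant_eventually[N [_ fD]].
have [n Nn /= /primezE[fn fn_pr]] := infinite_set_unbounded hinf N.
have adm : coprimez f.[n%:Z] D.
  rewrite fn coprimezE prime_coprime //; apply/negP => /(dvdn_leq (disc_gt0 hD)).
  by have := fD n Nn; lia.
pose a : 'I_`|D|%N := Ordinal (ltn_pmod n (disc_gt0 hD)).
move/eqP; rewrite -leqn0 leqNgt => /negP; apply; apply/card_gt0P; exists a.
rewrite inE /admissible /=.
have := quad_char_sqr f.[n%:Z] hD; rewrite adm.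
rewrite (@quad_char_mod D hD _ f.[(n %% `|D|)%N%:Z]) ?quad_char_sqr //; first by case: coprimez.
by apply: horner_eqmod; rewrite -(modz_abs n) -(modz_abs (_ %% _)%N) !modz_nat /= modn_mod.
Qed.

Lemma nonconstant_cvg : (1 < size f)%N ->
  (inert_ratio R D f @ \oo --> ((nb_inert_residues D f)%:R / (nb_admissible D f)%:R : R))%classic.
Proof.
move=> f1; have A0 := nonconstant_admissible f1.
have [N [f_incr fD]] := nonconstant_eventually f1.
have horner_mono := horner_mono f_incr.
have fn_ge n : (N <= n)%N -> (n - N)%N%:Z <= f.[n%:Z].
  move=> Nn; rewrite -{2}(subnKC Nn); elim: (n - N)%N => [|k IHk].
    by rewrite addn0; have := fD N (leqnn N); lia.
  by have := f_incr (N + k)%N (leq_addr _ _); rewrite addnS; lia.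
(* X(x) is the last argument from N on with value at most x; it turns limits over arguments into
   limits over values. For x < f(N) the value 0 is arbitrary. *)
have last_arg x : exists X, f.[N%:Z] <= x%:Z ->
    [/\ (N <= X)%N, f.[X%:Z] <= x%:Z & x%:Z < f.[X.+1%:Z]].
  have [Nx|] := boolP (f.[N%:Z] <= x%:Z); last by exists 0%N.
  have exX : exists n, (N <= n)%N && (f.[n%:Z] <= x%:Z) by exists N; rewrite leqnn.
  have bX n : (N <= n)%N && (f.[n%:Z] <= x%:Z) -> (n <= N + x)%N.
    by move=> /andP[Nn fx]; have := fn_ge n Nn; lia.
  case: (ex_maxnP exX bX) => X /andP[NX fX] maxX; exists X => _; split=> //.
  rewrite ltNge; apply/negP => fX1.
  by have := maxX X.+1; rewrite fX1 (leqW NX) ltnn => /(_ isT).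
have [X XP] := choice last_arg.
have x0 : (\forall x \near \oo, f.[N%:Z] <= x%:Z)%classic.
  by exists `|f.[N%:Z]|%N => // x /=; lia.
have X_oo : (X @ \oo --> \oo)%classic.
  move=> S [K _ SK]; exists `|f.[(maxn K N)%:Z]|%N => // x /= fx; apply: SK => /=.
  have Nx : f.[N%:Z] <= x%:Z by have := horner_mono N (maxn K N) (leqnn N) (leq_maxr K N); lia.
  have [NX _ xX] := XP x Nx; rewrite leqNgt; apply/negP => XK.
  have := horner_mono (X x).+1 (maxn K N) (leqW NX); rewrite leq_max XK => /(_ isT); lia.
have -> : inert_ratio R D f = (fun x => (nb_values f (fun p => `[< inert D p >]) x)%:R
    / (nb_values f predT x)%:R) by apply/funext => x; exact: inert_ratioE.
(* One N pays for passing from values to arguments, the other for replacing inertness by the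
   character. *)
apply: (@cvg_ratio_bounded_diff R (N + N) _ _
  (fun x => nb_inert_args D f (X x)) (fun x => nb_prime_args f (X x))).
- apply: filterS x0 => x /XP[NX fX xX].
  have := nb_values_le f_incr (fun p => `[< inert D p >]) NX xX.
  have := nb_args_le f_incr (fun p => `[< inert D p >]) fX.
  have := nb_inert_args_bounds hD (X x) fD; lia.
- apply: filterS x0 => x /XP[NX fX xX]; rewrite nb_prime_argsE.
  have := nb_values_le f_incr predT NX xX; have := nb_args_le f_incr predT fX; lia.
- exact: (cvg_comp _ _ X_oo (@nb_prime_args_cvg R f hinf)).
- exact: (cvg_comp _ _ X_oo (@nb_inert_args_cvg R D f hD hequi A0)).
Qed.

(** Only the prime q is represented, so the ratio is 0 or 1 as soon as x >= q. *)
Lemma constant_cvg q : f = q%:Z%:P -> prime q ->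
  (inert_ratio R D f @ \oo --> ((`[< inert D q >] : nat)%:R : R))%classic.
Proof.
move=> fE q_pr; apply: cvg_near_cst; exists q => // x /= qx.
have nbE Q : nb_values f Q x = Q q.
  have repE p : `[< represented f p >] = (p == q).
    apply/asboolP/eqP => [[n]|->]; first by rewrite fE hornerC => -[].
    by exists 0%N; rewrite fE hornerC.
  rewrite /nb_values (eq_count (a2 := fun p => Q q && (p == q))); last first.
    by move=> p /=; rewrite repE; case: eqP => [->|]; rewrite ?andbF // q_pr andbT.
  case: (Q q); last exact: count_pred0.
  rewrite -[LHS]/(count_mem q (iota 0 x.+1)).
  by rewrite count_uniq_mem ?iota_uniq // mem_iota add0n ltnS qx.
by rewrite inert_ratioE !nbE divr1.
Qed.

(** The character takes the same value chi(q) at every residue: all are admissible, and all or none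
    are inert. *)
Lemma constant_density q : f = q%:Z%:P -> prime q -> nb_admissible D f <> 0%N ->
  (`[< inert D q >] : nat)%:R = (nb_inert_residues D f)%:R / (nb_admissible D f)%:R :> R.
Proof.
move=> fE q_pr A0.
have qD : coprimez q D.
  apply: contrapT => /negP qD; apply: A0; apply: eq_card0 => a.
  by rewrite inE /admissible fE hornerC (negPf qD).
have AE : nb_admissible D f = `|D|%N.
  rewrite -[RHS]card_ord; apply: eq_card => a.
  by rewrite !inE /admissible fE hornerC qD.
have D0 : `|D|%N%:R != 0 :> R by rewrite pnatr_eq0 -lt0n disc_gt0.
have iE : `[< inert D q >] = (quad_char D q == -1).
  by apply/asboolP/eqP; apply inert_quad_char.
rewrite AE iE; have [e1|e1] := boolP (quad_char D q == -1).
  have -> : nb_inert_residues D f = `|D|%N; last by rewrite divff.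
  by rewrite -[RHS]card_ord; apply: eq_card => a; rewrite !inE fE hornerC e1.
have -> : nb_inert_residues D f = 0%N; last by rewrite mul0r.
by apply: eq_card0 => a; rewrite !inE fE hornerC (negPf e1).
Qed.

(** The formula is conditional because a constant prime dividing D has no admissible residue,
    although its limit exists and is rational. *)
Lemma inert_ratio_cvg : exists2 l : rat,
  (inert_ratio R D f @ \oo --> (ratr l : R))%classic &
  nb_admissible D f <> 0%N ->
    ratr l = (nb_inert_residues D f)%:R / (nb_admissible D f)%:R :> R.
Proof.
have [f1|f1] := ltnP 1 (size f).
  exists ((nb_inert_residues D f)%:R / (nb_admissible D f)%:R);
    rewrite fmorph_div !rmorph_nat //.
  exact: nonconstant_cvg.
have fE := size1_polyC f1.
have [n _ /= fn] := infinite_set_unbounded hinf 0.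
have /primezE[cE q_pr] : primez f`_0 by move: fn; rewrite {1}fE hornerC.
move: fE; rewrite cE => fE.
exists (`[< inert D (absz f`_0) >] : nat)%:R; rewrite rmorph_nat.
  exact: constant_cvg fE q_pr.
exact: constant_density fE q_pr.
Qed.
End Limit.

Theorem theorem1 (R : realType) (f : {poly int}) (D : int)
    (hD : fundamental_discriminant D)
    (hinf : infinite_set [set n : nat | primez f.[n%:Z]]%classic)
    (hequi : equidistributed R D f) :
  [/\ cvgn (inert_ratio R D f),
      exists q : rat, tau_minus R D f = ratr q
    & let D1 := largest_odd_divisor D in
      let a := a_coef R f D1 in
      let al := alpha R f in
      (1 < D1)%N -> coefficients_defined D f ->
      [/\ ~~ (2 %| D)%Z ->
            2 * tau_minus R D f = 1 - a,
          (D = 4 %[mod 8])%Z ->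
            2 * tau_minus R D f =
              1 + (al 3%N + al 7%N - al 1%N - al 5%N) * a,
          (D = 8 %[mod 32])%Z ->
            2 * tau_minus R D f =
              1 + (al 3%N + al 5%N - al 1%N - al 7%N) * a
        & (D = 24 %[mod 32])%Z ->
            2 * tau_minus R D f =
              1 + (al 5%N + al 7%N - al 1%N - al 3%N) * a]].
Proof.
have [l cvg_l lE] := inert_ratio_cvg hD hinf hequi.
have tauE : tau_minus R D f = ratr l by apply: cvg_lim => //; exact: Rhausdorff.
split=> [||/= _ coef]; [exact: cvgP cvg_l|by exists l|].
have A0 := coefficients_defined_admissible hD coef.
rewrite tauE lE // inert_density //.
split=> DE.
- by rewrite two_part_ratio1 ?mul1r // /two_part DE.
- rewrite two_part_ratioN4; first by ring.
  rewrite /two_part; have -> : (2 %| D)%Z by lia.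
  by move/eqP: DE => ->.
- rewrite two_part_ratio8; first by ring.
  rewrite /two_part; have -> : (2 %| D)%Z by lia.
  have -> : (D == 4 %[mod 8])%Z = false by lia.
  by move/eqP: DE => ->.
- rewrite two_part_ratioN8; first by ring.
  rewrite /two_part; have -> : (2 %| D)%Z by lia.
  have -> : (D == 4 %[mod 8])%Z = false by lia.
  by have -> : (D == 8 %[mod 32])%Z = false by lia.
Qed.
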